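(* Let $(J,h)\in\Gamma$, let $m_1<m_2$ be the two maximizers of $\tilde p$ on $[0,1]$, and let $\xi\in(m_1,m_2)$. For each $N$ let $D$ be a random dimer configuration sampled from the Gibbs measure $\mathbb{P}$ of the imitative monomer-dimer model on the complete graph with $N$ vertices and parameters $(J,h)$, and set $\mathscr{D}_1=\{D\in\mathscr{D}:m(D)<\xi\}$, $\mathscr{D}_2=\{D\in\mathscr{D}:m(D)>\xi\}$. Then for $\ell=1,2$ one has $\lambda_\ell:=-\tilde p''(m_\ell)^{-1}-(2J)^{-1}>0$, and there exists a constant $K>0$ (independent of $N$) such that for $\ell=1,2$ and all $N\ge1$ with $\mathbb{P}(\mathscr{D}_\ell)>0$, $$\sup_{z\in\mathbb{R}}\Bigl|\mathbb{P}\Bigl(\frac{|\mathscr{M}(D)|-Nm_\ell}{N^{1/2}}\le z\,\Big|\,\mathscr{D}_\ell\Bigr)-\mathbb{P}(X_\ell\le z)\Bigr|\le\frac{K}{N^{1/2}},$$ where $X_\ell$ is a normal random variable with mean zero and variance $\lambda_\ell$.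
   Context: Model. For $N\ge1$ let $V=\{1,\dots,N\}$ and let $E=\{uv\equiv\{u,v\}:u,v\in V,\ u<v\}$ be the edge set of the complete graph on $V$. A dimer configuration is a set $D\subseteq E$ of pairwise vertex-disjoint edges (possibly empty); $\mathscr{D}$ is the set of all dimer configurations. The monomer set $\mathscr{M}(D)$ is the set of vertices not covered by any edge of $D$, so $2|D|+|\mathscr{M}(D)|=N$. The monomer density is $m(D)=|\mathscr{M}(D)|/N$. With $a=J$ and $b=\frac{\log N}{2}+h-J$, the Hamiltonian is $-H(D)=N(a\,m(D)^2+b\,m(D))$ and the Gibbs measure is $\mathbb{P}(D)=e^{-H(D)}/\sum_{D'\in\mathscr{D}}e^{-H(D')}$. Variational function. Let $$g(x)=\tfrac12\bigl(\sqrt{e^{4x}+4e^{2x}}-e^{2x}\bigr),\qquad \tau(x)=(2x-1)J+h,$$ $$\tilde p(m)=-Jm^2-\tfrac12\Bigl(1-g(\tau(m))+\log\bigl(1-g(\tau(m))\bigr)\Bigr),\quad m\in[0,1].$$ Derivatives of $\tilde p$ are with respect to $m$. Critical line (known facts used to define the objects). Let $J_c=\frac{1}{4(3-2\sqrt2)}$ and $h_c=\frac12\log(2\sqrt2-2)-\frac14$. There is a function $\gamma:[J_c,\infty)\to\mathbb{R}$ with $\gamma(J_c)=h_c$ such that, with $\Gamma:=\{(J,\gamma(J)):J>J_c\}$: if $J>0$ and $(J,h)\notin\Gamma$, then $\tilde p$ has a unique maximizer on $[0,1]$; if $(J,h)\in\Gamma$, then $\tilde p$ has exactly two distinct maximizers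 $m_1<m_2$ on $[0,1]$, they satisfy $m_\ell=g(\tau(m_\ell))$ and $\tilde p''(m_\ell)<0$ for $\ell=1,2$, and the law of $m(D)$ converges weakly to $p_1\delta_{m_1}+p_2\delta_{m_2}$ for some $p_1,p_2>0$ as $N\to\infty$. *)

(* Defs.v *)
From HB Require Import structures.
From mathcomp Require Import all_boot all_order all_algebra.
From mathcomp Require Import all_classical all_reals all_analysis.
Set Implicit Arguments.
Unset Strict Implicit.
Unset Printing Implicit Defensive.
Import Order.TTheory GRing.Theory Num.Theory.
Import numFieldNormedType.Exports.
Local Open Scope ring_scope.

(* The vertex set {1, ..., N} is 'I_N, and an edge uv is the 2-element set
   {u, v}. *)
Definition edges (N : nat) : {set {set 'I_N}} :=
  [set e : {set 'I_N} | #|e| == 2%N]%SET.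

(* For a set of edges, trivIset says that distinct edges share no vertex. *)
Definition dimers (N : nat) : {set {set {set 'I_N}}} :=
  [set D : {set {set 'I_N}} | (D \subset edges N) && finset.trivIset D]%SET.

Definition monomers (N : nat) (D : {set {set 'I_N}}) : {set 'I_N} :=
  (~: finset.cover D)%SET.

Definition density (R : realType) (N : nat) (D : {set {set 'I_N}}) : R :=
  #|monomers D|%:R / N%:R.
Arguments density R {N} D.

Definition hamiltonian (R : realType) (J h : R) (N : nat)
    (D : {set {set 'I_N}}) : R :=
  let a := J in
  let b := ln (N%:R : R) / 2 + h - J in
  - (N%:R * (a * density R D ^+ 2 + b * density R D)).

Definition partition_function (R : realType) (J h : R) (N : nat) : R :=
  \sum_(D in dimers N) expR (- hamiltonian J h D).

Definition gibbs (R : realType) (J h : R) (N : nat)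
    (D : {set {set 'I_N}}) : R :=
  expR (- hamiltonian J h D) / partition_function J h N.

Definition prob (R : realType) (J h : R) (N : nat)
    (A : {set {set {set 'I_N}}}) : R :=
  \sum_(D in dimers N | D \in A) gibbs J h D.

Definition cond_prob (R : realType) (J h : R) (N : nat)
    (A B : {set {set {set 'I_N}}}) : R :=
  prob J h (A :&: B)%SET / prob J h B.

Definition dimers_lt (R : realType) (xi : R) (N : nat) :
    {set {set {set 'I_N}}} :=
  [set D in dimers N | density R D < xi]%SET.

Definition dimers_gt (R : realType) (xi : R) (N : nat) :
    {set {set {set 'I_N}}} :=
  [set D in dimers N | density R D > xi]%SET.

Definition rescaled_le (R : realType) (m : R) (N : nat) (z : R) :
    {set {set {set 'I_N}}} :=
  [set D in dimers N |
    (#|monomers D|%:R - N%:R * m) / Num.sqrt N%:R <= z]%SET.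

Definition g (R : realType) (x : R) : R :=
  (Num.sqrt (expR (4 * x) + 4 * expR (2 * x)) - expR (2 * x)) / 2.

Definition tau (R : realType) (J h x : R) : R := (2 * x - 1) * J + h.

Definition ptilde (R : realType) (J h m : R) : R :=
  - (J * m ^+ 2) -
  (1 - g (tau J h m) + ln (1 - g (tau J h m))) / 2.

Definition is_maximizer (R : realType) (J h m : R) : Prop :=
  0 <= m <= 1 /\
  forall x : R, 0 <= x <= 1 -> ptilde J h x <= ptilde J h m.

Definition Jc (R : realType) : R := (4 * (3 - 2 * Num.sqrt 2))^-1.
Definition hc (R : realType) : R := ln (2 * Num.sqrt 2 - 2) / 2 - 4^-1.
Arguments Jc R : clear implicits.
Arguments hc R : clear implicits.

Definition Gamma (R : realType) (gamma : R -> R) (J h : R) : Prop :=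
  Jc R < J /\ h = gamma J.

(* Only the values of gamma on [Jc, +oo[ matter, and these requirements
   determine them: for J > Jc, gamma J is the only h for which the maximizer
   of ptilde is not unique. *)
Definition critical_line (R : realType) (gamma : R -> R) : Prop :=
  [/\ gamma (Jc R) = hc R,
      (forall J h : R, 0 < J -> ~ Gamma gamma J h ->
         exists m : R, forall x : R, is_maximizer J h x <-> x = m)
    & (forall J h : R, Gamma gamma J h ->
         exists m1 m2 : R, m1 < m2 /\
           forall x : R, is_maximizer J h x <-> x = m1 \/ x = m2)].

Definition limit_variance (R : realType) (J h m : R) : R :=
  - (derive1n 2 (ptilde J h) m)^-1 - (2 * J)^-1.

(* normal_prob takes the standard deviation, not the variance; it is the
   normal law only for a nonzero one. *)
Definition centered_normal_cdf (R : realType) (v z : R) : R :=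
  fine (normal_prob (0 : R) (Num.sqrt v) `]-oo, z]%classic).

(* Main.v *)
Require Import Defs.
From HB Require Import structures.
From mathcomp Require Import all_boot all_order all_algebra.
From mathcomp Require Import all_classical all_reals all_analysis.
From mathcomp Require Import ring lra zify.
Set Implicit Arguments.
Unset Strict Implicit.
Unset Printing Implicit Defensive.
Import Order.TTheory GRing.Theory Num.Theory.
Import numFieldNormedType.Exports.
Local Open Scope ring_scope.

(** The monomer number is a one-dimensional statistic with explicit weights: the
    complete graph on [N] vertices has [N! / (k! d! 2^d)] dimer configurations
    with [k] monomers and [d] dimers ([card_matchings]), and they all have the
    same energy.  The theorem is therefore a quantitative local limit theorem for
    the weights [expR (log_weight J h N k d)] on the lattice [k + 2 d = N].

    The weights grow like [expR (N * exponent J h (k / N))].  Linearising the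
    quadratic interaction shows that [ptilde J h m] is the maximum over [x] of
    [exponent J h x - J (x - m)^2] ([exponent_le_ptilde], [exponent_g_tau]).  So
    [exponent] and [ptilde] have the same maximizers, these are fixed points of
    [g \o tau], and [ptilde] being smooth up to the boundary, a compactness
    argument on [ptilde] bounds [exponent] away from its maximum outside any
    neighbourhood of the maximizer in the window ([window_gap]).  The variance in
    the theorem is the inverse of [curvature], which is minus the second
    derivative of [exponent].  It is positive because two distinct maximizers
    force, by Rolle's theorem, two roots of a concave quadratic strictly between
    them ([two_maximizers_nondegenerate]).

    Near a maximizer [m] the precise asymptotics come from the ratio of
    consecutive weights, in which the factorials cancel: its logarithm is
    [- 2 curvature (x - m)] up to [O((x - m)^2 + 1 / N)] ([log_ratio_linear]).
    Summing from the lattice point closest to [N m], and writing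
    [t = (k - N m) / sqrt N], the logarithm of the weight is
    [- curvature t^2 / 2] up to a cubic error of size [1 / sqrt N]
    ([log_weight_gaussian]).  Far from [m] Stirling's formula up to polynomial
    factors suffices.  Together: relative to the peak, every weight
    differs from the Gaussian by [O(1 / (sqrt N (1 + t^2)))] ([local_estimate]).

    The factor [1 / (1 + t^2)] has bounded Riemann sums, so that comparing each
    weight with the normal mass of the cell of length [2 / sqrt N] to its right
    costs [O(1 / sqrt N)] in total ([normalized_partial_sums_near_cdf]).
    Conditioning on a window of densities sets the weights outside it to zero,
    and there the Gaussian obeys the same bound; hence both phases are
    instances of one statement, [window_berry_esseen]. *)

(** * Elementary inequalities *)

Section elementary.
Context {R : realType}.
Implicit Types (x y t c : R).

Lemma ler_dist_expR x y M : x <= M -> y <= M ->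
  `|expR x - expR y| <= `|x - y| * expR M.
Proof.
have half u v : v <= u -> u <= M -> expR u - expR v <= (u - v) * expR M.
  move=> vu uM; have := expR_ge1Dx (v - u); rewrite expRB => H.
  have -> : expR u - expR v = expR u * (1 - expR v / expR u).
    by rewrite mulrBr mulr1 mulrC divfK// gt_eqF// expR_gt0.
  apply: (@le_trans _ _ (expR u * (u - v))); last first.
    by rewrite mulrC ler_wpM2l ?subr_ge0// ler_expR.
  by rewrite ler_wpM2l ?expR_ge0//; lra.
move=> xM yM; have [yx|xy] := leP y x.
  by rewrite !ger0_norm ?subr_ge0 ?ler_expR// half.
by rewrite distrC (distrC x) !ger0_norm ?subr_ge0 ?ler_expR ?(ltW xy)// half// ltW.
Qed.

Lemma poly_gauss_bounded c n : 0 < c ->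
  exists2 C, 0 < C & forall t, (1 + t ^+ 2) ^+ n.+1 * expR (- (c * t ^+ 2)) <= C.
Proof.
move=> c0; exists (expR c * n.+1`!%:R / c ^+ n.+1).
  by rewrite divr_gt0 ?exprn_gt0// mulr_gt0 ?expR_gt0// ltr0n fact_gt0.
move=> t; have t1 : 0 <= 1 + t ^+ 2 by rewrite addr_ge0// sqr_ge0.
have /(expR_ge1Dxn n) : 0 <= c * (1 + t ^+ 2) by rewrite mulr_ge0// ltW.
rewrite exprMn mulrDr mulr1 expRD => H.
have f0 : 0 < n.+1`!%:R :> R by rewrite ltr0n fact_gt0.
rewrite ler_pdivlMr ?exprn_gt0// expRN mulrAC ler_pdivrMr ?expR_gt0//.
rewrite (mulrC (expR c)) -mulrA -ler_pdivrMl// mulrC.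
by move: H; rewrite (mulrC (c ^+ _)); lra.
Qed.

Lemma ln1D_quadratic t : `|t| <= 2^-1 -> `|ln (1 + t) - t| <= 2 * t ^+ 2.
Proof.
move=> t2; have /andP[tl tr] : - 2^-1 <= t <= 2^-1 by rewrite -ler_norml.
have t1 : 0 < 1 + t by lra.
have le : ln (1 + t) <= t by apply: le_ln1Dx; lra.
rewrite ler0_norm ?subr_le0//.
have : ln (1 + - t / (1 + t)) <= - t / (1 + t).
  by apply: le_ln1Dx; rewrite ltr_pdivlMr//; lra.
have -> : 1 + - t / (1 + t) = (1 + t)^-1 by field; rewrite gt_eqF.
rewrite lnV ?posrE// => H.
suff : - t / (1 + t) <= 2 * t ^+ 2 - t by lra.
rewrite ler_pdivrMr// -subr_ge0.
have -> : (2 * t ^+ 2 - t) * (1 + t) - - t = t ^+ 2 * (1 + 2 * t) by ring.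
by rewrite mulr_ge0 ?sqr_ge0//; lra.
Qed.

End elementary.

(** * Comparing lattice weights with a distribution function *)

Section lattice_sums.
Context {R : realType}.
Implicit Types (x y t : R).

(** An increasing bounded function whose increments dominate those of a measure
    of density [(1 + t ^+ 2)^-1], up to a constant: sums of such increments
    telescope. *)
Definition softsign t : R := t / (1 + `|t|).

Lemma softsign_bounded t : -1 <= softsign t <= 1.
Proof.
have h : 0 < 1 + `|t| by rewrite ltr_wpDr.
rewrite -ler_norml /softsign normrM normfV (gtr0_norm h) ler_pdivrMr// mul1r.
by rewrite lerDr.
Qed.

Lemma softsign_step t t' : t <= t' <= t + 2 ->
  (t' - t) / (1 + t ^+ 2) <= 6 * (softsign t' - softsign t).
Proof.
move=> /andP[tt' t't]; rewrite /softsign.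
have [h h'] : 0 < 1 + `|t| /\ 0 < 1 + `|t'| by rewrite !ltr_wpDr.
have s0 : 0 < 1 + t ^+ 2 by rewrite ltr_wpDr// sqr_ge0.
apply: (@le_trans _ _ (6 * ((t' - t) / ((1 + `|t|) * (1 + `|t'|))))).
  rewrite mulrCA ler_wpM2l ?subr_ge0// -[leLHS]mul1r ler_pdivrMr// mulrAC.
  rewrite ler_pdivlMr ?mulr_gt0// mul1r.
  have tn : `|t'| <= `|t| + 2.
    have := ler_normD t (t' - t); rewrite [t + _]addrC subrK.
    by rewrite (@ger0_norm _ (t' - t)) ?subr_ge0//; lra.
  apply: (@le_trans _ _ ((1 + `|t|) * (3 + `|t|))); first by rewrite ler_wpM2l//; lra.
  rewrite -(real_normK (num_real t)) -subr_ge0.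
  have -> : 6 * (1 + `|t| ^+ 2) - (1 + `|t|) * (3 + `|t|) =
    (2 * `|t| - 1) ^+ 2 + `|t| ^+ 2 + 2 by ring.
  by rewrite !addr_ge0 ?sqr_ge0.
rewrite ler_pM2l// -subr_ge0.
have -> : t' / (1 + `|t'|) - t / (1 + `|t|) - (t' - t) / ((1 + `|t|) * (1 + `|t'|))
   = (t' * `|t| - t * `|t'|) / ((1 + `|t|) * (1 + `|t'|)).
  by field; rewrite !gt_eqF.
rewrite divr_ge0 ?(ltW (mulr_gt0 h h'))// subr_ge0.
by case: (ger0P t) => t0; case: (ger0P t') => t'0; nra.
Qed.

Lemma sum_softsign (t : nat -> R) n : (forall i, t i <= t i.+1 <= t i + 2) ->
  \sum_(i < n) (t i.+1 - t i) / (1 + t i ^+ 2) <= 12.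
Proof.
move=> H; apply: (@le_trans _ _ (6 * (softsign (t n) - softsign (t 0%N)))); last first.
  have /andP[_ ?] := softsign_bounded (t n).
  by have /andP[? _] := softsign_bounded (t 0%N); lra.
elim: n => [|n IH]; first by rewrite big_ord0 subrr mulr0.
by rewrite big_ord_recr/=; have := softsign_step (H n); lra.
Qed.

(** The increments of [Phi] over the cells that start below [z] telescope to the
    value of [Phi] at the end of the last of these cells, minus [Phi (t 0)]; this
    differs from [Phi z] by one cell or by a tail. *)
Lemma partial_sums_near_cdf (Phi : R -> R) (t u : nat -> R) n eps :
  {homo Phi : x y / x <= y} -> (forall x, 0 <= Phi x <= 1) ->
  (forall i, t i <= t i.+1) ->
  (forall i, (i < n)%N -> Phi (t i.+1) - Phi (t i) <= eps) ->
  Phi (t 0%N) <= eps -> 1 - Phi (t n) <= eps ->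
  \sum_(i < n) `|u i - (Phi (t i.+1) - Phi (t i))| <= eps ->
  forall z, `|\sum_(i < n | t i <= z) u i - Phi z| <= 3 * eps.
Proof.
move=> Pm P01 tm cell lo hi err z.
set T := \sum_(i < n | t i <= z) (Phi (t i.+1) - Phi (t i)).
have eps0 : 0 <= eps by have := P01 (t 0%N); lra.
have D : `|\sum_(i < n | t i <= z) u i - T| <= eps.
  rewrite /T -sumrB; apply: (le_trans (ler_norm_sum _ _ _)).
  apply: le_trans err; rewrite [leRHS](bigID (fun i : 'I_n => t i <= z))/=.
  by rewrite lerDl sumr_ge0.
(* the two upper bounds and the case distinction together encode that the sum
   is the increment of [Phi] from [t 0] to the smaller of [t k] and the end of
   the cell of [z], or zero if [z] precedes [t 0] *)
have key k : (k <= n)%N ->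
    let S := \sum_(i < k) (if t i <= z then Phi (t i.+1) - Phi (t i) else 0) in
    [/\ S <= Phi (t k) - Phi (t 0%N), S <= Num.max 0 (Phi z + eps - Phi (t 0%N)) &
    if t k <= z then S = Phi (t k) - Phi (t 0%N) else
      Phi z - Phi (t 0%N) <= S].
  elim: k => [_ /=|k IH kn /=].
    rewrite big_ord0 subrr le_max lexx; split => //.
    by case: ifPn => //; rewrite -ltNge => /ltW/Pm; lra.
  have [] := IH (ltnW kn); rewrite big_ord_recr/=.
  set S := \sum_(i < k) _; have := Pm _ _ (tm k); have := cell _ kn.
  case: ifPn => [tkz|ztk] c1 c2 S1 S2 S3.
    rewrite S3 addrC subrKA; have := Pm _ _ tkz => tz; split => //.
      by rewrite le_max; apply/orP; right; lra.
    by case: ifPn => //; rewrite -ltNge => /ltW/Pm; lra.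
  rewrite addr0; split => //; first lra.
  by case: ifPn => // tk1; case/negP: ztk; exact: le_trans tk1.
have [] := key n (leqnn n); rewrite /= -big_mkcond -/T => T1 T2 T3.
have := P01 z; have := P01 (t 0%N); have := P01 (t n) => n01 z01 t01.
have : - (2 * eps) <= T - Phi z <= 2 * eps.
  have T2' : T <= Phi z + eps.
    apply: (le_trans T2); rewrite ge_max; lra.
  case: ifPn T3 => [tnz ->|_ T3]; first by have := Pm _ _ tnz; lra.
  by lra.
by move: D; rewrite !ler_norml; lra.
Qed.

(** Letting [z] be the last point shows that the total weight is itself close to
    [1], so that dividing by it costs a further [4 * eps]. *)
Lemma normalized_partial_sums_near_cdf (Phi : R -> R) (t u : nat -> R) n eps :
  {homo Phi : x y / x <= y} -> (forall x, 0 <= Phi x <= 1) ->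
  (forall i, t i <= t i.+1) -> (forall i, 0 <= u i) ->
  (forall i, (i < n)%N -> Phi (t i.+1) - Phi (t i) <= eps) ->
  Phi (t 0%N) <= eps -> 1 - Phi (t n) <= eps ->
  \sum_(i < n) `|u i - (Phi (t i.+1) - Phi (t i))| <= eps ->
  0 < \sum_(i < n) u i ->
  forall z, `|(\sum_(i < n | t i <= z) u i) / (\sum_(i < n) u i) - Phi z| <= 7 * eps.
Proof.
move=> Pm P01 tm u0 cell lo hi err U0 z.
have eps0 : 0 <= eps by have := P01 (t 0%N); lra.
have near := partial_sums_near_cdf Pm P01 tm cell lo hi err.
set U := \sum_(i < n) u i in U0 *.
have tmn : {homo t : i j / (i <= j)%N >-> i <= j} by exact: (homo_leq le_refl le_trans).
have U1 : `|U - 1| <= 4 * eps.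
  have := near (t n); rewrite (eq_bigl predT); last first.
    by move=> i /=; rewrite tmn// ltnW.
  rewrite -/U !ler_norml; have := P01 (t n); lra.
set S := \sum_(i < n | t i <= z) u i.
have SU : 0 <= S <= U.
  rewrite /S sumr_ge0//= /U [leRHS](bigID (fun i : 'I_n => t i <= z))/=.
  by rewrite lerDl sumr_ge0.
have -> : S / U - Phi z = (S - Phi z) + S / U * (1 - U).
  by field; rewrite gt_eqF.
apply: (le_trans (ler_normD _ _)).
have -> : 7 * eps = 3 * eps + 4 * eps by ring.
rewrite lerD ?near// normrM distrC; apply: le_trans U1.
have /andP[S0 SleU] := SU.
by rewrite ler_piMl// ger0_norm ?(divr_ge0 S0 (ltW U0))// ler_pdivrMr// mul1r.
Qed.

End lattice_sums.

(** * The centered normal distribution function *)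

Section normal_cdf.
Context {R : realType}.
Variable v : R.
Hypothesis v0 : 0 < v.
Implicit Types x y t : R.
Local Notation mu := (@lebesgue_measure R).
Local Notation Phi := (centered_normal_cdf v).
Local Notation nu := (normal_prob (0 : R) (Num.sqrt v)).

(** The density at [0] of the centered normal law of variance [v]. *)
Definition normal_height : R := normal_peak (Num.sqrt v).

Lemma normal_height_gt0 : 0 < normal_height.
Proof. by rewrite normal_peak_gt0// gt_eqF// sqrtr_gt0. Qed.

Lemma normal_pdf_height x :
  normal_pdf 0 (Num.sqrt v) x = normal_height * expR (- x ^+ 2 / (2 * v)).
Proof.
rewrite normal_pdfE ?gt_eqF ?sqrtr_gt0// /normal_fun subr0 sqr_sqrtr ?ltW//.
by rewrite mulr_natl.
Qed.

Lemma normal_cdf_bounded x : 0 <= Phi x <= 1.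
Proof.
rewrite /centered_normal_cdf; apply/andP; split; first exact: fine_ge0.
by rewrite -lee_fin fineK ?fin_num_measure// probability_le1.
Qed.

Lemma normal_cdf_increment x y : x <= y -> (Phi y - Phi x)%:E = nu `]x, y]%classic.
Proof.
move=> xy; rewrite /centered_normal_cdf EFinB !fineK ?fin_num_measure//.
have -> : `]x, y]%classic = (`]-oo, y] `\` `]-oo, x])%classic.
  apply/seteqP; split=> z /=; rewrite !in_itv/=.
    by move=> /andP[xz ->]; split => //; apply/negP; rewrite -ltNge.
  by move=> [-> /negP]; rewrite -ltNge => ->.
rewrite measureD//=; last by rewrite (le_lt_trans (probability_le1 _ _)) ?ltry.
rewrite (_ : (`]-oo, y] `&` `]-oo, x] = `]-oo, x])%classic)//.
apply/seteqP; split=> z /=; rewrite !in_itv/=; first by case.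
by move=> zx; split => //; exact: le_trans xy.
Qed.

Lemma normal_cdf_homo : {homo Phi : x y / x <= y}.
Proof.
by move=> x y xy; rewrite -subr_ge0 -lee_fin normal_cdf_increment.
Qed.

Lemma normal_cdf_increment_bounds x y lo hi : x <= y ->
  (forall u, x <= u <= y -> lo <= expR (- u ^+ 2 / (2 * v)) <= hi) -> 0 <= lo ->
  normal_height * lo * (y - x) <= Phi y - Phi x <= normal_height * hi * (y - x).
Proof.
move=> xy H lo0; have s0 := normal_height_gt0.
have leb : mu `]x, y]%classic = (y - x)%:E.
  rewrite lebesgue_measure_itv/= lte_fin; case: ltP => //= yx.
  by have -> : x = y; [apply/le_anti; rewrite xy yx|rewrite subrr].
rewrite -!lee_fin normal_cdf_increment// [in X in _ && X]EFinM -leb EFinM -leb.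
have mI : measurable (`]x, y]%classic : set R) by [].
rewrite -!(@integral_cst _ _ _ mu)// /normal_prob; apply/andP; split.
- apply: ge0_le_integral => //=.
  + by move=> *; rewrite lee_fin mulr_ge0// ltW.
  + apply/measurable_realfun.measurable_EFinP/measurable_funTS; exact: measurable_normal_pdf.
  + move=> u; rewrite in_itv/= => /andP[xu uy]; rewrite lee_fin normal_pdf_height.
    by rewrite ler_pM2l//; have /andP[] := H u (ltac:(by rewrite ltW)).
- apply: ge0_le_integral => //=.
  + by move=> *; rewrite lee_fin normal_pdf_ge0.
  + apply/measurable_realfun.measurable_EFinP/measurable_funTS; exact: measurable_normal_pdf.
  + move=> u; rewrite in_itv/= => /andP[xu uy]; rewrite lee_fin normal_pdf_height.
    by rewrite ler_pM2l//; have /andP[] := H u (ltac:(by rewrite ltW)).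
Qed.

Let idR : measurableTypeR R -> R := idfun.

#[local] HB.instance Definition _ :=
  @isMeasurableFun.Build _ _ _ _ idR (@measurable_id _ _ setT).

Lemma normal_cdf_cvgy : (Phi x @[x --> +oo%R] --> (1 : R))%classic.
Proof.
have := cvg_cdfy1 (idR : {RV (nu : probability _ R) >-> R}).
have -> : cdf (idR : {RV (nu : probability _ R) >-> R}) = EFin \o Phi.
  apply/funext => x; rewrite /cdf /distribution /pushforward /= preimage_id.
  by rewrite fineK// fin_num_measure.
by move=> /fine_cvgP[_]; apply: cvg_trans.
Qed.

Lemma normal_cdf_cvgNy : (Phi x @[x --> -oo%R] --> (0 : R))%classic.
Proof.
have := cvg_cdfNy0 (idR : {RV (nu : probability _ R) >-> R}).
have -> : cdf (idR : {RV (nu : probability _ R) >-> R}) = EFin \o Phi.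
  apply/funext => x; rewrite /cdf /distribution /pushforward /= preimage_id.
  by rewrite fineK// fin_num_measure.
by move=> /fine_cvgP[_]; apply: cvg_trans.
Qed.

(** Moving by at most [1] costs half of the quadratic exponent and a constant. *)
Lemma sqr_near x u : (x - u) ^+ 2 <= 1 -> x ^+ 2 / 2 - 1 <= u ^+ 2.
Proof.
have -> : u ^+ 2 = x ^+ 2 / 2 - (x - u) ^+ 2 + (x - 2 * u) ^+ 2 / 2 by field.
by have := sqr_ge0 (x - 2 * u); lra.
Qed.

(** The density is Lipschitz with a constant that decays like a Gaussian, hence
    faster than [(1 + x ^+ 2)^-1]. *)
Lemma gauss_cell : exists2 C, 0 < C & forall x u, x <= u <= x + 1 ->
  `|expR (- u ^+ 2 / (2 * v)) - expR (- x ^+ 2 / (2 * v))| <= C * (u - x) / (1 + x ^+ 2).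
Proof.
have c0 : 0 < (4 * v)^-1 by rewrite invr_gt0 mulr_gt0.
have [C C0 HC] := poly_gauss_bounded 1 c0.
exists (v^-1 * expR (2 * v)^-1 * C * 2).
  by rewrite !mulr_gt0 ?invr_gt0 ?expR_gt0 ?mulr_gt0.
move=> x u /andP[xu ux]; have x1 : 0 < 1 + x ^+ 2 by rewrite ltr_wpDr// sqr_ge0.
have M1 : - u ^+ 2 / (2 * v) <= (2 * v)^-1 - (4 * v)^-1 * x ^+ 2.
  have : x ^+ 2 / 2 - 1 <= u ^+ 2 by apply: sqr_near; rewrite -sqrrN; nra.
  rewrite -(@ler_pM2r _ (2 * v)^-1) ?invr_gt0 ?mulr_gt0//.
  have -> : (x ^+ 2 / 2 - 1) / (2 * v) = (4 * v)^-1 * x ^+ 2 - (2 * v)^-1.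
    by field; rewrite gt_eqF.
  by lra.
have M2 : - x ^+ 2 / (2 * v) <= (2 * v)^-1 - (4 * v)^-1 * x ^+ 2.
  have -> : (2 * v)^-1 - (4 * v)^-1 * x ^+ 2 =
     - x ^+ 2 / (2 * v) + (2 * v)^-1 + x ^+ 2 / (4 * v).
    by field; rewrite gt_eqF.
  have p1 : 0 <= (2 * v)^-1 by rewrite invr_ge0 mulr_ge0// ltW.
  have p2 : 0 <= x ^+ 2 / (4 * v) by rewrite divr_ge0 ?sqr_ge0// mulr_ge0// ltW.
  by lra.
apply: (le_trans (ler_dist_expR M1 M2)).
have -> : - u ^+ 2 / (2 * v) - - x ^+ 2 / (2 * v) = - ((u - x) * (u + x) / (2 * v)).
  by field; rewrite gt_eqF.
rewrite normrN !normrM normfV (ger0_norm (_ : 0 <= u - x)) ?subr_ge0//.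
rewrite (gtr0_norm (_ : 0 < 2 * v)) ?mulr_gt0// expRD.
have ub : `|u + x| <= 2 * (1 + x ^+ 2).
  rewrite ler_norml; have := sqr_ge0 (x - 1); have := sqr_ge0 (x + 1).
  by move=> a b; nra.
have := HC x; rewrite -[in X in X -> _]mulNr => H.
rewrite ler_pdivlMr//.
have -> : v^-1 * expR (2 * v)^-1 * C * 2 * (u - x) =
  (u - x) * (2 * 1) / (2 * v) * expR (2 * v)^-1 * (2 * C).
  by field; rewrite gt_eqF.
apply: (@le_trans _ _ ((u - x) * (2 * (1 + x ^+ 2)) / (2 * v) *
   (expR (2 * v)^-1 * expR (- (4 * v)^-1 * x ^+ 2)) * (1 + x ^+ 2))).
  rewrite ler_wpM2r ?(ltW x1)// mulNr ler_wpM2r ?mulr_ge0 ?expR_ge0//.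
  rewrite ler_wpM2r ?invr_ge0 ?mulr_ge0 ?(ltW v0)// ler_wpM2l ?subr_ge0//.
have -> : (u - x) * (2 * (1 + x ^+ 2)) / (2 * v) *
   (expR (2 * v)^-1 * expR (- (4 * v)^-1 * x ^+ 2)) * (1 + x ^+ 2) =
  (u - x) * (2 * 1) / (2 * v) * expR (2 * v)^-1 *
     ((1 + x ^+ 2) ^+ 2 * expR (- (4 * v)^-1 * x ^+ 2)) by ring.
rewrite ler_wpM2l ?mulr_ge0 ?subr_ge0 ?expR_ge0 ?invr_ge0 ?mulr_ge0 ?(ltW v0)//.
by apply: (le_trans H); lra.
Qed.

(** The error is quadratic in the width of the cell and carries an integrable
    factor, so it remains small after summing over a lattice of cells. *)
Lemma normal_cdf_cell : exists2 C, 0 < C & forall x w, 0 <= w <= 1 ->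
  `|Phi (x + w) - Phi x - normal_height * expR (- x ^+ 2 / (2 * v)) * w| <=
    C * w ^+ 2 / (1 + x ^+ 2).
Proof.
have [C C0 HC] := gauss_cell; have s0 := normal_height_gt0.
exists (normal_height * C); first exact: mulr_gt0.
move=> x w /andP[w0 w1]; set e := expR _.
have x1 : 0 < 1 + x ^+ 2 by rewrite ltr_wpDr// sqr_ge0.
set eta := C * w / (1 + x ^+ 2).
have near_e u : x <= u <= x + w -> e - eta <= expR (- u ^+ 2 / (2 * v)) <= e + eta.
  move=> /andP[xu ux]; have := HC x u; rewrite xu (le_trans ux) ?lerD2l// => /(_ isT).
  rewrite -/e -ler_distl => /le_trans; apply.
  by rewrite ler_wpM2r ?invr_ge0 ?(ltW x1)// ler_wpM2l ?(ltW C0)//; lra.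
have := @normal_cdf_increment_bounds x (x + w) (Num.max 0 (e - eta)) (e + eta).
rewrite lerDl w0 le_max lexx => /(_ isT) /(_ _ isT) H.
have : normal_height * Num.max 0 (e - eta) * (x + w - x) <=
    Phi (x + w) - Phi x <= normal_height * (e + eta) * (x + w - x).
  apply: H => u /near_e /andP[eu ->]; rewrite andbT ge_max eu andbT.
  exact: expR_ge0.
have -> : x + w - x = w by ring.
move=> /andP[H1 H2].
have -> : normal_height * C * w ^+ 2 / (1 + x ^+ 2) = normal_height * eta * w.
  by rewrite /eta; ring.
rewrite ler_norml; apply/andP; split; last by move: H2; lra.
have : normal_height * (e - eta) * w <= normal_height * Num.max 0 (e - eta) * w.
  by rewrite ler_wpM2r// ler_wpM2l ?(ltW s0)// le_max lexx orbT.
by move: H1; lra.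
Qed.

(** On cells of width at most [1] the density is dominated by the increments of
    [softsign]; longer intervals are cut into such cells. *)
Lemma normal_cdf_softsign : exists2 C : R, 0 < C & forall x y, x <= y ->
  Phi y - Phi x <= C * (softsign y - softsign x).
Proof.
have [C C0 HC] := normal_cdf_cell; have s0 := normal_height_gt0.
have c0 : 0 < (2 * v)^-1 by rewrite invr_gt0 mulr_gt0.
have [C1 C10 HC1] := poly_gauss_bounded 0 c0.
pose K := 6 * (normal_height * C1 + C).
have unit x w : 0 <= w <= 1 ->
    Phi (x + w) - Phi x <= K * (softsign (x + w) - softsign x).
  move=> /andP[w0 w1]; have x1 : 0 < 1 + x ^+ 2 by rewrite ltr_wpDr// sqr_ge0.
  have sq := @softsign_step R x (x + w); rewrite lerDl w0 lerD2l in sq.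
  have {sq} : (x + w - x) / (1 + x ^+ 2) <= 6 * (softsign (x + w) - softsign x).
    by apply: sq; lra.
  have -> : x + w - x = w by ring.
  move=> sq; have := HC x w; rewrite w0 w1 => /(_ isT) /ler_normlW H.
  have e1 : expR (- x ^+ 2 / (2 * v)) <= C1 / (1 + x ^+ 2).
    rewrite (_ : - x ^+ 2 / (2 * v) = - ((2 * v)^-1 * x ^+ 2)); last by ring.
    by rewrite ler_pdivlMr// mulrC; exact: HC1.
  have e2 : normal_height * expR (- x ^+ 2 / (2 * v)) * w <=
      normal_height * (C1 / (1 + x ^+ 2)) * w.
    by rewrite ler_wpM2r// ler_wpM2l// ltW.
  have e3 : C * w ^+ 2 / (1 + x ^+ 2) <= C * w / (1 + x ^+ 2).
    rewrite ler_wpM2r ?invr_ge0 ?(ltW x1)// ler_wpM2l ?(ltW C0)//.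
    by rewrite expr2 ler_piMl.
  have e4 : (normal_height * C1 + C) * (w / (1 + x ^+ 2)) <=
      (normal_height * C1 + C) * (6 * (softsign (x + w) - softsign x)).
    by rewrite ler_wpM2l// addr_ge0 ?mulr_ge0 ?ltW.
  by rewrite /K; move: H e2 e3 e4; lra.
exists K; first by rewrite !mulr_gt0// addr_gt0// mulr_gt0.
have steps x w n : 0 <= w <= 1 ->
    Phi (x + n%:R * w) - Phi x <= K * (softsign (x + n%:R * w) - softsign x).
  move=> w01; elim: n => [|n IH]; first by rewrite mul0r addr0 !subrr mulr0.
  have := unit (x + n%:R * w) w w01.
  have -> : x + n.+1%:R * w = x + n%:R * w + w by rewrite -natr1; ring.
  by move: IH; lra.
move=> x y xy; pose n := (Num.truncn (y - x)).+1.
have n0 : 0 < n%:R :> R by rewrite ltr0n.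
have := steps x ((y - x) / n%:R) n.
have -> : x + n%:R * ((y - x) / n%:R) = y by field; rewrite gt_eqF.
apply.
rewrite divr_ge0 ?subr_ge0 ?ler0n//= ler_pdivrMr// mul1r.
by rewrite ltW// truncnS_gt.
Qed.

(** The rate [1 / t] is far from optimal, but [t] will be of order [sqrt N]. *)
Lemma normal_cdf_tails : exists2 C, 0 < C & forall t, 0 < t ->
  Phi (- t) <= C / t /\ 1 - Phi t <= C / t.
Proof.
have [C C0 HC] := normal_cdf_softsign; exists C => // t t0.
have sq : 1 - softsign t <= t^-1.
  rewrite /softsign gtr0_norm//.
  have -> : 1 - t / (1 + t) = (1 + t)^-1 by field; rewrite gt_eqF// addr_gt0.
  by rewrite lef_pV2 ?posrE ?addr_gt0// lerDr.
split.
  rewrite -subr_le0; apply: (cvgr_to_ge normal_cdf_cvgNy); near=> y.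
  have yt : y <= - t by near: y; apply: nbhs_ninfty_le; exact: num_real.
  have := HC _ _ yt; have /andP[sy _] := softsign_bounded y.
  have -> : softsign (- t) = - softsign t by rewrite /softsign normrN mulNr.
  have : C * (- softsign t - softsign y) <= C / t by rewrite ler_pM2l//; lra.
  lra.
rewrite lerBlDr addrC; apply: (cvgr_to_le normal_cdf_cvgy); near=> y.
have ty : t <= y by near: y; apply: nbhs_pinfty_ge; exact: num_real.
have := HC _ _ ty; have /andP[_ sy] := softsign_bounded y.
have : C * (softsign y - softsign t) <= C / t by rewrite ler_pM2l//; lra.
lra.
Unshelve. all: by end_near. Qed.

End normal_cdf.

(** * Derivatives of the variational function *)

(** The differentiation rules, with the functions written pointwise so that they
    compose by unification. *)
Section pointwise_derivatives.
Context {R : realType}.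
Implicit Types (f : R -> R) (x a b : R).

Lemma is_derive_add f1 f2 x a b : is_derive x 1 f1 a -> is_derive x 1 f2 b ->
  is_derive x 1 (fun y => f1 y + f2 y) (a + b).
Proof. by move=> ? ?; exact: is_deriveD. Qed.

Lemma is_derive_sub f1 f2 x a b : is_derive x 1 f1 a -> is_derive x 1 f2 b ->
  is_derive x 1 (fun y => f1 y - f2 y) (a - b).
Proof. by move=> ? ?; exact: is_deriveB. Qed.

Lemma is_derive_mull c f x a : is_derive x 1 f a ->
  is_derive x 1 (fun y => c * f y) (c * a).
Proof. by move=> ?; exact: (@is_deriveZ _ _ _ f c). Qed.

Lemma is_derive_chain f1 f2 x a b : is_derive (f2 x) 1 f1 a ->
  is_derive x 1 f2 b -> is_derive x 1 (fun y => f1 (f2 y)) (a * b).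
Proof. exact: is_derive1_comp. Qed.

Lemma is_derive_const c x : is_derive x 1 (fun=> c) (0 : R).
Proof. exact: is_derive_cst. Qed.

Lemma is_derive_var x : is_derive x 1 (fun y : R => y) 1.
Proof. exact: is_derive_id. Qed.

End pointwise_derivatives.

Section g_facts.
Context {R : realType}.
Implicit Types x : R.

Lemma g_sqrt_gt0 x : 0 < expR (4 * x) + 4 * expR (2 * x).
Proof. by rewrite addr_gt0 ?mulr_gt0 ?expR_gt0. Qed.

Lemma expR4 x : expR (4 * x) = expR (2 * x) ^+ 2.
Proof. by rewrite -expRM_natl; congr expR; ring. Qed.

Lemma g_sqr x : g x ^+ 2 = expR (2 * x) * (1 - g x).
Proof.
have /ltW/sqr_sqrtr := g_sqrt_gt0 x.
rewrite /g expR4; set E := expR (2 * x); set s := Num.sqrt _ => sE.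
have -> : ((s - E) / 2) ^+ 2 = (s ^+ 2 - 2 * s * E + E ^+ 2) / 4 by field.
by rewrite sE; field.
Qed.

Lemma g_gt0 x : 0 < g x.
Proof.
have E0 := expR_gt0 (2 * x).
rewrite /g divr_gt0// subr_gt0 -[ltLHS]gtr0_norm// -sqrtr_sqr.
by rewrite ltr_sqrt ?g_sqrt_gt0// expR4 ltrDl mulr_gt0.
Qed.

Lemma g_lt1 x : g x < 1.
Proof.
have : 0 < expR (2 * x) * (1 - g x) by rewrite -g_sqr exprn_gt0// g_gt0.
by rewrite pmulr_rgt0 ?expR_gt0// subr_gt0.
Qed.

(** Differentiating [g ^+ 2 = expR (2 * x) * (1 - g)] and eliminating the
    exponential by the same equation gives this form of the derivative. *)
Lemma is_derive_g x : is_derive x 1 (@g R) (2 * g x * (1 - g x) / (2 - g x)).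
Proof.
have s0 := g_sqrt_gt0 x.
have dexp c : is_derive x 1 (fun y : R => expR (c * y)) (expR (c * x) * (c * 1)).
  exact: (is_derive_chain (is_derive_expR _) (is_derive_mull c (is_derive_var x))).
have dS : is_derive x 1 (@g R) (2^-1 *
   ((2 * Num.sqrt (expR (4 * x) + 4 * expR (2 * x)))^-1 *
     (expR (4 * x) * (4 * 1) + 4 * (expR (2 * x) * (2 * 1)))
    - expR (2 * x) * (2 * 1))).
  have -> : @g R = fun y => 2^-1 *
      (Num.sqrt (expR (4 * y) + 4 * expR (2 * y)) - expR (2 * y)).
    by apply/funext => y; rewrite /g mulrC.
  apply: is_derive_mull (is_derive_sub _ (dexp 2)).
  exact: (@is_derive_chain _ Num.sqrt (fun y => expR (4 * y) + 4 * expR (2 * y)))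
    (is_derive1_sqrt s0)
    (is_derive_add (dexp 4) (is_derive_mull 4 (dexp 2))).
apply: (is_derive_eq dS).
have g0 := g_gt0 x; have g1 := g_lt1 x; have gE := g_sqr x.
have sqE : Num.sqrt (expR (4 * x) + 4 * expR (2 * x)) = 2 * g x + expR (2 * x).
  by rewrite /g; field.
rewrite sqE expR4.
have u1 : 1 - g x != 0 by rewrite gt_eqF// subr_gt0.
have EE : expR (2 * x) = g x ^+ 2 / (1 - g x) by rewrite gE mulfK.
have s2 : 2 * g x + expR (2 * x) = g x * (2 - g x) / (1 - g x).
  by rewrite EE; field.
rewrite s2 EE; move: (g x) g0 g1 u1 {gE EE sqE dS s2} => u u0 u1 u1n.
by field; rewrite u1n !gt_eqF//; lra.
Qed.

End g_facts.

Section ptilde_calculus.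
Context {R : realType}.
Variables (J h : R).
Implicit Types x m : R.

Lemma is_derive_tau x : is_derive x 1 (tau J h) (2 * J).
Proof.
have -> : tau J h = fun y => (2 * J) * y + (h - J).
  by apply/funext => y; rewrite /tau; ring.
have d := is_derive_add (is_derive_mull (2 * J) (is_derive_var x)) (is_derive_const (h - J) x).
by apply: (is_derive_eq d); ring.
Qed.

Lemma is_derive_g_tau x : is_derive x 1 (fun y => g (tau J h y))
  (2 * J * (2 * g (tau J h x) * (1 - g (tau J h x)) / (2 - g (tau J h x)))).
Proof.
rewrite mulrC; exact: is_derive_chain (is_derive_g _) (is_derive_tau _).
Qed.

Lemma is_derive_ptilde x :
  is_derive x 1 (ptilde J h) (2 * J * (g (tau J h x) - x)).
Proof.
have g0 := g_gt0 (tau J h x); have g1 := g_lt1 (tau J h x).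
have dG := is_derive_g_tau x; set G' := 2 * J * _ in dG.
have dom : is_derive x 1 (fun y => 1 - g (tau J h y)) (0 - G').
  exact: is_derive_sub (is_derive_const _ _) dG.
have dl : is_derive x 1 (fun y => ln (1 - g (tau J h y)))
    ((1 - g (tau J h x))^-1 * (0 - G')).
  apply: (@is_derive_chain _ (@ln R) (fun y => 1 - g (tau J h y))) dom.
  by apply: is_derive1_ln; rewrite subr_gt0.
have -> : ptilde J h = fun y => (- J) * (y * y) -
    2^-1 * (1 - g (tau J h y) + ln (1 - g (tau J h y))).
  by apply/funext => y; rewrite /ptilde; ring.
have dsq : is_derive x 1 (fun y : R => y * y) (x * 1 + x * 1).
  exact: is_deriveM (is_derive_var x) (is_derive_var x).
have d := is_derive_sub (is_derive_mull (- J) dsq)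
  (is_derive_mull 2^-1 (is_derive_add dom dl)).
apply: (is_derive_eq d).
rewrite /G'; field.
by rewrite !subr_eq0 ![_ == g _]eq_sym !lt_eqF//; lra.
Qed.

Lemma is_derive2_ptilde x : is_derive x 1 (fun y => 2 * J * (g (tau J h y) - y))
  (2 * J * (2 * J * (2 * g (tau J h x) * (1 - g (tau J h x)) /
    (2 - g (tau J h x))) - 1)).
Proof.
exact: is_derive_mull _ (is_derive_sub (is_derive_g_tau _) (is_derive_var _)).
Qed.

Lemma derive2_ptilde x : derive1n 2 (ptilde J h) x =
  2 * J * (2 * J * (2 * g (tau J h x) * (1 - g (tau J h x)) /
    (2 - g (tau J h x))) - 1).
Proof.
rewrite derive1nS derive1n1.
have -> : (ptilde J h)^`()%classic = fun y => 2 * J * (g (tau J h y) - y).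
  by apply/funext => y; rewrite derive1E; exact/derive_val/is_derive_ptilde.
by rewrite derive1E; exact/derive_val/is_derive2_ptilde.
Qed.

Lemma continuous_is_derive (f df : R -> R) :
  (forall x, is_derive x 1 f (df x)) -> continuous f.
Proof.
move=> H x; apply: differentiable_continuous; apply/derivable1_diffP.
by have [] := H x.
Qed.

Lemma continuous_ptilde : continuous (ptilde J h).
Proof. exact: (continuous_is_derive is_derive_ptilde). Qed.

End ptilde_calculus.

(** * The variational principle and its maximizers *)

Section variational.
Context {R : realType}.
Variables (J h : R).
Implicit Types x m : R.

(** The exponential growth rate, per vertex, of the total weight of the
    configurations with monomer density [x], normalized so that its maximum is
    that of [ptilde]. *)
Definition exponent x : R :=
  J * x ^+ 2 + (h - J) * x - x * ln x - (1 - x) / 2 * ln (1 - x) + x / 2 - 2^-1.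

Lemma mulr_ln_le x y : 0 <= x -> 0 < y -> x * (ln y - ln x) <= y - x.
Proof.
rewrite le_eqVlt => /predU1P[<-|x0] y0; first by rewrite mul0r subr0 ltW.
have yx : -1 < y / x - 1 by rewrite -[ltLHS]add0r ltrD2r divr_gt0.
have := le_ln1Dx yx; rewrite addrC subrK ln_div ?posrE// => H.
apply: (le_trans (ler_wpM2l (ltW x0) H)).
by rewrite mulrBr mulr1 mulrC divfK// gt_eqF.
Qed.

Lemma ln_g (t : R) : ln (g t) = t + ln (1 - g t) / 2.
Proof.
have g0 := g_gt0 t; have g1 : 0 < 1 - g t by rewrite subr_gt0 g_lt1.
have := congr1 (@ln R) (g_sqr t).
rewrite lnM ?posrE ?expR_gt0// expRK expr2 lnM ?posrE// => E.
by lra.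
Qed.

(** [ptilde m] is the maximum over [x] of the left-hand side (attained at
    [g (tau J h m)]): the quadratic interaction is linearised around [m], and
    what remains is Gibbs' inequality [x ln (G / x) <= G - x], once for [x] and
    once for [1 - x]. *)
Lemma exponent_le_ptilde x m : 0 <= x <= 1 ->
  exponent x - J * (x - m) ^+ 2 <= ptilde J h m.
Proof.
move=> /andP[x0 x1]; rewrite /ptilde; set t := tau J h m.
have g0 := g_gt0 t; have g1 : 0 < 1 - g t by rewrite subr_gt0 g_lt1.
have := mulr_ln_le x0 g0; have := mulr_ln_le (_ : 0 <= 1 - x) g1.
rewrite subr_ge0 x1 => /(_ isT); rewrite ln_g /exponent.
have -> : J * x ^+ 2 + (h - J) * x = t * x + J * x ^+ 2 - 2 * J * m * x.
  by rewrite /t /tau; ring.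
by lra.
Qed.

Lemma exponent_g_tau m :
  exponent (g (tau J h m)) - J * (g (tau J h m) - m) ^+ 2 = ptilde J h m.
Proof.
rewrite /ptilde; set t := tau J h m.
rewrite /exponent ln_g; set x := g t.
have -> : J * x ^+ 2 + (h - J) * x = t * x + J * x ^+ 2 - 2 * J * m * x.
  by rewrite /t /tau; ring.
by field.
Qed.

(** With [x = g (tau J h m)], both results above give
    [ptilde m = exponent x - J (x - m)^2 <= ptilde x - J (x - m)^2], which for a
    maximizer [m] forces [x = m]. *)
Lemma maximizer_fixed m : 0 < J -> is_maximizer J h m -> g (tau J h m) = m.
Proof.
move=> J0 [m01 mmax]; have g0 := g_gt0 (tau J h m); have g1 := g_lt1 (tau J h m).
have g01 : 0 <= g (tau J h m) <= 1 by rewrite !ltW.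
have := exponent_le_ptilde (g (tau J h m)) g01.
rewrite subrr expr0n mulr0 subr0 => le1.
have := exponent_g_tau m => E.
have := le_trans le1 (mmax _ g01); rewrite -E => le2.
have : J * (g (tau J h m) - m) ^+ 2 <= 0 by lra.
by rewrite pmulr_rle0// => le0; apply/eqP; rewrite -subr_eq0 -sqrf_eq0 eq_le le0 sqr_ge0.
Qed.

Lemma exponent_fixed m : g (tau J h m) = m -> exponent m = ptilde J h m.
Proof.
by move=> gm; rewrite -exponent_g_tau gm subrr expr0n mulr0 subr0.
Qed.

Lemma exponent_le_ptilde_diag x : 0 <= x <= 1 -> exponent x <= ptilde J h x.
Proof. by move=> /(exponent_le_ptilde x); rewrite subrr expr0n mulr0 subr0. Qed.

Lemma limit_varianceE m : 0 < J -> g (tau J h m) = m -> 4 * J * m * (1 - m) < 2 - m ->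
  limit_variance J h m = 2 * m * (1 - m) / (2 - m - 4 * J * m * (1 - m)).
Proof.
move=> J0 gm Qm; have m0 := g_gt0 (tau J h m); have m1 := g_lt1 (tau J h m).
rewrite gm in m0 m1.
rewrite /limit_variance derive2_ptilde gm.
have n2 : 2 - m != 0 by rewrite gt_eqF// subr_gt0; lra.
have nQ : 2 - m - 4 * J * m * (1 - m) != 0 by rewrite gt_eqF// subr_gt0; lra.
have -> : 2 * J * (2 * J * (2 * m * (1 - m) / (2 - m)) - 1) =
  - (2 * J * (2 - m - 4 * J * m * (1 - m)) / (2 - m)) by field.
by field; rewrite n2 nQ gt_eqF.
Qed.

Lemma g_tau_incr : 0 < J -> {homo (fun x => g (tau J h x)) : x y / x < y}.
Proof.
move=> J0 x y xy.
have [//|c _ E] := MVT xy (fun z _ => is_derive_g_tau J h z).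
  apply: continuous_subspaceT.
  exact: (continuous_is_derive (fun z => is_derive_g_tau J h z)).
rewrite -subr_gt0 E; have c0 := g_gt0 (tau J h c); have c1 := g_lt1 (tau J h c).
move: (g _) c0 c1 => u u0 u1.
by rewrite !mulr_gt0 ?invr_gt0 ?subr_gt0//; lra.
Qed.

(** Rolle's theorem on [ptilde] gives a third critical point between the two
    maximizers; Rolle's theorem on its derivative then gives two zeros of
    [ptilde'']. Through [g \o tau], which is increasing, they become two roots of
    the concave quadratic [4 J y (1 - y) - (2 - y)] that lie strictly between
    [m1] and [m2]. *)
Lemma two_maximizers_nondegenerate m1 m2 : 0 < J -> m1 < m2 ->
  is_maximizer J h m1 -> is_maximizer J h m2 ->
  4 * J * m1 * (1 - m1) < 2 - m1 /\ 4 * J * m2 * (1 - m2) < 2 - m2.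
Proof.
move=> J0 m12 M1 M2.
have g1 := maximizer_fixed J0 M1; have g2 := maximizer_fixed J0 M2.
have pE : ptilde J h m1 = ptilde J h m2.
  by apply/eqP; rewrite eq_le (M1.2 _ M2.1) (M2.2 _ M1.1).
have nJ : 2 * J != 0 by rewrite gt_eqF// mulr_gt0.
have dp x := is_derive_ptilde J h x.
have d2p x := is_derive2_ptilde J h x.
have [x _|||c cI cE] := @Rolle R (ptilde J h) m1 m2 m12; first by have [] := dp x.
- exact/continuous_subspaceT/continuous_ptilde.
- exact: pE.
have gc : g (tau J h c) = c.
  have : 2 * J * (g (tau J h c) - c) = 0.
    by rewrite -(@derive_val _ _ _ _ _ _ _ (dp c)) (@derive_val _ _ _ _ _ _ _ cE).
  by move/eqP; rewrite mulf_eq0 (negbTE nJ)/= subr_eq0 => /eqP.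
have root a b : a < b -> g (tau J h a) = a -> g (tau J h b) = b ->
    exists2 y, a < y < b & 4 * J * y * (1 - y) = 2 - y.
  move=> ab ga gb.
  have [x _|||r rI rE] := @Rolle R (fun y => 2 * J * (g (tau J h y) - y)) a b ab.
  - by have [] := d2p x.
  - exact/continuous_subspaceT/(continuous_is_derive d2p).
  - by rewrite ga gb !subrr.
  move: rI; rewrite in_itv/= => /andP[ar rb].
  exists (g (tau J h r)).
    by have /= := g_tau_incr J0 ar; have /= := g_tau_incr J0 rb; rewrite ga gb => -> ->.
  have := @derive_val _ _ _ _ _ _ _ (d2p r).
  rewrite (@derive_val _ _ _ _ _ _ _ rE); have := g_lt1 (tau J h r).
  move: (g _) => y y1 /esym/eqP; rewrite mulf_eq0 (negbTE nJ)/= subr_eq0 => /eqP.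
  have n2 : 2 - y != 0 by rewrite gt_eqF// subr_gt0; lra.
  move=> /(congr1 (fun u => u * (2 - y))).
  by rewrite mulrA divfK// mul1r => <-; ring.
move: cI; rewrite in_itv/= => /andP[m1c cm2].
have [y /andP[m1y yc] yE] := root _ _ m1c g1 gc.
have [z /andP[cz zm2] zE] := root _ _ cm2 gc g2.
(* both roots being known, the quadratic is [- 4 J (m - y) (m - z)] *)
have yz : y < z by lra.
have S : 4 * J * (y + z) = 4 * J + 1.
  apply: (@mulfI _ (z - y)); first by rewrite gt_eqF// subr_gt0.
  by move: yE zE; lra.
have fac m : 2 - m - 4 * J * m * (1 - m) = 4 * J * ((m - y) * (m - z)).
  have -> : 4 * J * ((m - y) * (m - z)) =
    4 * J * m ^+ 2 - 4 * J * (y + z) * m + (4 * J * (y + z)) * y - 4 * J * y ^+ 2 by ring.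
  by rewrite S; move: yE; lra.
have pos m : 0 < (m - y) * (m - z) -> 4 * J * m * (1 - m) < 2 - m.
  by move=> ?; rewrite -subr_gt0 fac mulr_gt0 ?(mulr_gt0 _ J0).
have m1z := lt_trans m1c cz; have ym2 := lt_trans yc cm2.
by split; apply: pos; [rewrite nmulr_rgt0 ?subr_lt0|rewrite mulr_gt0 ?subr_gt0].
Qed.

End variational.

Lemma EVT_gap {R : realType} (f : R -> R) (l r M : R) : continuous f ->
  (forall x, l <= x <= r -> f x < M) ->
  exists2 c, 0 < c & forall x, l <= x <= r -> f x <= M - c.
Proof.
move=> cf lt; have [lr|rl] := leP l r; last first.
  by exists 1 => // x /andP[lx xr]; have := le_trans lx xr; rewrite leNgt rl.
have [y yI ymax] := EVT_max lr (continuous_subspaceT cf).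
exists (M - f y); first by rewrite subr_gt0 lt//; rewrite in_itv in yI.
by move=> x xI; rewrite subKr ymax// in_itv.
Qed.

(** [ptilde] is smooth on the whole line, so compactness applies up to the
    boundary of the unit interval, where the logarithms in [exponent] are
    singular. *)
Lemma window_gap {R : realType} (J h a b m d : R) : 0 < d ->
  (forall x, 0 <= x <= 1 -> a <= x <= b -> x != m -> ptilde J h x < ptilde J h m) ->
  exists2 c, 0 < c & forall x, 0 <= x <= 1 -> a <= x <= b -> d <= `|x - m| ->
    ptilde J h x <= ptilde J h m - c.
Proof.
move=> d0 H; have cp := @continuous_ptilde R J h.
have [x|c1 c10 H1] := @EVT_gap R _ (Num.max 0 a) (Num.min (Num.min 1 b) (m - d)) (ptilde J h m) cp.
  rewrite ge_max !le_min => /andP[/andP[x0 ax] /andP[/andP[x1 xb] xm]].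
  by apply: H; rewrite ?x0 ?ax// lt_eqF//; lra.
have [x|c2 c20 H2] := @EVT_gap R _ (Num.max (Num.max 0 a) (m + d)) (Num.min 1 b) (ptilde J h m) cp.
  rewrite !ge_max !le_min => /andP[/andP[/andP[x0 ax] xm] /andP[x1 xb]].
  by apply: H; rewrite ?x0 ?ax// gt_eqF//; lra.
exists (Num.min c1 c2); first by rewrite lt_min c10.
move=> x /andP[x0 x1] /andP[ax xb]; rewrite ler_normr => /orP[xm|xm].
  have /H2 : Num.max (Num.max 0 a) (m + d) <= x <= Num.min 1 b.
    by rewrite !ge_max le_min x0 ax x1 xb andbT/=; lra.
  by move/le_trans; apply; rewrite lerD2l lerN2 ge_min lexx orbT.
have /H1 : Num.max 0 a <= x <= Num.min (Num.min 1 b) (m - d).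
  by rewrite ge_max !le_min x0 ax x1 xb/=; lra.
by move/le_trans; apply; rewrite lerD2l lerN2 ge_min lexx.
Qed.

(** * Counting dimer configurations *)

Definition matchings (N d : nat) : {set {set {set 'I_N}}} :=
  [set D in dimers N | #|D| == d]%SET.

Lemma mem_matchings (N d : nat) (D : {set {set 'I_N}}) :
  (D \in matchings N d) = (D \in dimers N) && (#|D| == d).
Proof. by rewrite inE. Qed.

Lemma card_dimer_cover (N : nat) (D : {set {set 'I_N}}) :
  D \in dimers N -> #|finset.cover D| = (2 * #|D|)%N.
Proof.
rewrite inE => /andP[sub /eqP <-].
rewrite (eq_bigr (fun=> 2%N)) ?sum_nat_const 1?mulnC// => e eD.
by have /(fintype.subsetP sub) := eD; rewrite inE => /eqP.
Qed.

Lemma card_monomers (N : nat) (D : {set {set 'I_N}}) :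
  D \in dimers N -> (#|monomers D| + 2 * #|D|)%N = N.
Proof.
by move=> /card_dimer_cover <-; rewrite addnC /monomers finset.cardsC card_ord.
Qed.

Lemma dimersU1 (N : nat) (D : {set {set 'I_N}}) (e : {set 'I_N}) :
  D \in dimers N -> e \subset monomers D -> #|e| = 2%N ->
  (e |: D)%SET \in dimers N /\ e \notin D.
Proof.
rewrite inE => /andP[sub tD] eD e2.
have n0 : finset.set0 \notin D.
  by apply/negP => /(fintype.subsetP sub); rewrite inE cards0.
have dis f : f \in D -> [disjoint e & f].
  move=> fD; rewrite finset.disjoints_subset (fintype.subset_trans eD)//.
  by rewrite /monomers finset.setCS finset.bigcup_sup.
have [tU eND] := finset.trivIsetU1 dis tD n0; split => //.
rewrite inE tU andbT; apply/fintype.subsetP => f /[!inE] /orP[/eqP ->|]; first by rewrite e2.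
by move=> /(fintype.subsetP sub); rewrite inE.
Qed.

Lemma dimersD1 (N : nat) (D : {set {set 'I_N}}) (e : {set 'I_N}) :
  D \in dimers N -> e \in D ->
  [/\ (D :\ e)%SET \in dimers N, e \subset monomers (D :\ e)%SET & #|e| = 2%N].
Proof.
rewrite inE => /andP[sub tD] eD; split.
- rewrite inE finset.trivIsetD// andbT.
  exact: fintype.subset_trans (finset.subD1set _ _) sub.
- rewrite /monomers finset.coverD1// finset.setDE finset.setCI finset.setCK.
  exact: finset.subsetUr.
- by have /(fintype.subsetP sub) := eD; rewrite inE => /eqP.
Qed.

(** Both sides count the pairs of a matching with [d.+1] edges and one edge of
    it: removing the edge leaves a matching with [d] edges and two of its
    monomers. *)
Lemma card_matchingsS (N d : nat) :
  (d.+1 * #|matchings N d.+1| = 'C(N - 2 * d, 2) * #|matchings N d|)%N.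
Proof.
transitivity (\sum_(p : {set {set 'I_N}} * {set 'I_N} |
    (p.1 \in matchings N d.+1) && (p.2 \in p.1)) 1)%N.
  rewrite -(pair_big_dep (fun D => D \in matchings N d.+1)
    (fun D e => e \in D) (fun _ _ => 1%N))/=.
  rewrite (eq_bigr (fun=> d.+1)) ?sum_nat_const 1?mulnC// => D.
  by rewrite inE sum1_card => /andP[_ /eqP].
rewrite (reindex_onto (fun p => ((p.2 |: p.1)%SET, p.2))
                      (fun p => ((p.1 :\ p.2)%SET, p.2))) /=; last first.
  by move=> [D e] /= /andP[_ eD]; rewrite finset.setD1K.
transitivity (\sum_(p : {set {set 'I_N}} * {set 'I_N} |
    (p.1 \in matchings N d) &&
    (p.2 \in [set e : {set 'I_N} | e \subset monomers p.1 & #|e| == 2%N]%SET)) 1)%N.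
  apply: eq_bigl => -[D e] /=; rewrite !mem_matchings/= setU11 andbT.
  have -> : (e \in [set e : {set 'I_N} | e \subset monomers D & #|e| == 2%N]%SET)
    = (e \subset monomers D) && (#|e| == 2%N) by rewrite inE.
  rewrite xpair_eqE eqxx andbT.
  apply/idP/idP => [/andP[/andP[H /eqP De] /eqP eDe]|].
    have eND : e \notin D by rewrite -eDe !inE eqxx.
    have [] := dimersD1 H (setU11 _ _).
    rewrite eDe => -> -> ->; rewrite eqxx !andbT /=.
    by rewrite -eqSS -De cardsU1 eND add1n.
  move=> /andP[/andP[DN /eqP Dd] /andP[eD /eqP e2]].
  have [-> eND] := dimersU1 DN eD e2.
  by rewrite cardsU1 eND Dd add1n eqxx/= finset.setU1K// eqxx.
rewrite -(pair_big_dep (fun D => D \in matchings N d) (fun D e => e \in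
  [set e : {set 'I_N} | e \subset monomers D & #|e| == 2%N]%SET) (fun _ _ => 1%N))/=.
rewrite (eq_bigr (fun=> 'C(N - 2 * d, 2))) ?sum_nat_const 1?mulnC// => D.
rewrite sum1_card cards_draws inE => /andP[/card_monomers DN /eqP Dd].
by congr 'C(_, _); rewrite Dd in DN; lia.
Qed.

Lemma card_matchings0 N : #|matchings N 0| = 1%N.
Proof.
apply/eqP/cards1P; exists finset.set0; apply/finset.setP => D.
rewrite mem_matchings finset.in_set1 cards_eq0 andb_idl// => /eqP ->.
rewrite inE finset.sub0set/=.
by apply/finset.trivIsetP => A B; rewrite inE.
Qed.

Lemma card_matchings (N d : nat) : (2 * d <= N)%N ->
  (#|matchings N d| * ((N - 2 * d)`! * d`! * 2 ^ d) = N`!)%N.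
Proof.
elim: d => [|d IH] dN; first by rewrite card_matchings0 muln0 subn0 !mul1n !muln1.
have eN : (N - 2 * d = (N - 2 * d.+1).+2)%N by lia.
have := card_matchingsS N d; have := IH ltac:(lia); rewrite eN.
set n := (N - 2 * d.+1)%N => <- AB.
have C2 : ('C(n.+2, 2) * 2 = n.+2 * n.+1)%N.
  by rewrite -[X in (_ * X)%N]/(2`!) bin_ffact !ffactnSr ffactn0 mul1n subn0 subSS subn0.
rewrite !factS expnS.
have -> a b c : (a * (b * (d.+1 * c) * (2 * 2 ^ d)) =
  2 * (d.+1 * a) * (b * c * 2 ^ d))%N by ring.
rewrite AB; have -> a b : (2 * ('C(n.+2, 2) * a) * b = 'C(n.+2, 2) * 2 * a * b)%N by ring.
by rewrite C2; ring.
Qed.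

(** * Logarithms of the weights *)

Section log_weight.
Context {R : realType}.
Implicit Types (J h m y : R) (N k d : nat).

Definition stirling_error (n : nat) : R := ln (n`!%:R) - n%:R * ln n%:R + n%:R.

Lemma ln_factS (n : nat) : ln ((n.+1)`!%:R) = ln n.+1%:R + ln (n`!%:R) :> R.
Proof. by rewrite factS natrM lnM ?posrE ?ltr0n ?fact_gt0. Qed.

(** The increment of the error is [1 - n * ln ((n + 1) / n)], which lies between
    [0] and [ln ((n + 1) / n)] because [ln (1 + y) <= y] for [y = 1 / n] and for
    [y = - 1 / (n + 1)]. *)
Lemma stirling_error_bounds n : 0 <= stirling_error n <= 1 + ln n%:R.
Proof.
rewrite /stirling_error; elim: n => [|n IH].
  by rewrite fact0 ln1 ln0// mul0r subrr !addr0 lexx ler01.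
rewrite ln_factS; case: n IH => [|n] IH.
  by rewrite fact0 ln1 mulr0 addr0 subr0 add0r addr0 ler01 lexx.
have n0 : 0 < n.+1%:R :> R by rewrite ltr0n.
have n1 : 0 < n.+2%:R :> R by rewrite ltr0n.
have nE : n.+2%:R = n.+1%:R + 1 :> R by rewrite natr1.
have up : n.+1%:R * (ln n.+2%:R - ln n.+1%:R) <= 1 :> R.
  have : ln (n.+2%:R / n.+1%:R) <= n.+1%:R^-1 :> R.
    have -> : n.+2%:R / n.+1%:R = 1 + n.+1%:R^-1 :> R.
      by rewrite nE mulrDl divff ?gt_eqF// mul1r.
    by apply: le_ln1Dx; rewrite (lt_trans _ (_ : 0 < _)) ?invr_gt0// ltrN10.
  by rewrite ln_div ?posrE// -(ler_pM2l n0) divff ?gt_eqF.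
have lo : 1 <= n.+2%:R * (ln n.+2%:R - ln n.+1%:R) :> R.
  have : ln (n.+1%:R / n.+2%:R) <= - n.+2%:R^-1 :> R.
    have -> : n.+1%:R / n.+2%:R = 1 + - n.+2%:R^-1 :> R.
      by rewrite nE; move: (n.+1%:R) n0 => a a0; field; rewrite gt_eqF// addr_gt0.
    by apply: le_ln1Dx; rewrite ltrN2 invf_lt1// ltr1n.
  by rewrite ln_div ?posrE// -(ler_pM2l n1) mulrN divff ?gt_eqF//; lra.
by move: IH up lo; rewrite nE; lra.
Qed.

(** For [k + 2 d = N], the logarithm of the number of configurations with [k]
    monomers and [d] dimers times their common Boltzmann factor. *)
Definition log_weight J h N k d : R :=
  ln (N`!%:R) - ln (k`!%:R) - ln (d`!%:R) - d%:R * ln 2 + k%:R / 2 * ln N%:R +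
  J * k%:R ^+ 2 / N%:R + (h - J) * k%:R.

Lemma natr_ln_div (a b : R) (k : nat) : 0 < a -> 0 < b ->
  k%:R * ln (a * k%:R / b) = k%:R * (ln a + ln k%:R - ln b).
Proof.
move=> a0 b0; case: k => [|k]; first by rewrite !mul0r.
by rewrite ln_div ?lnM ?posrE// ?mulr_gt0.
Qed.

(** Only the errors of [k] and [d] depend on the configuration, and they are at
    most logarithmic in [N]. *)
Lemma log_weight_exponent J h N k d : (0 < N)%N -> (k + 2 * d)%N = N ->
  log_weight J h N k d = N%:R * exponent J h (k%:R / N%:R) +
    (stirling_error N + N%:R * ln N%:R / 2) -
    stirling_error k - stirling_error d.
Proof.
move=> N0 kdN; have n0 : 0 < N%:R :> R by rewrite ltr0n.
have nn : N%:R != 0 :> R by rewrite gt_eqF.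
have NE : k%:R = N%:R - 2 * d%:R :> R by rewrite -kdN natrD natrM addrK.
have := @natr_ln_div 1 N%:R k ltr01 n0; rewrite mul1r ln1 add0r => kl.
have dl := @natr_ln_div 2 N%:R d (ltr0n _ _) n0.
have -> : N%:R * exponent J h (k%:R / N%:R) =
  J * k%:R ^+ 2 / N%:R + (h - J) * k%:R - k%:R * ln (k%:R / N%:R) -
  d%:R * ln (2 * d%:R / N%:R) + k%:R / 2 - N%:R / 2.
  rewrite /exponent.
  have -> : 1 - k%:R / N%:R = 2 * d%:R / N%:R :> R.
    by rewrite NE; field.
  move: (ln _) (ln (2 * _ / _)) => A B; rewrite NE. by field.
rewrite kl dl /log_weight /stirling_error.
by move: (ln N%:R) (ln k%:R) (ln d%:R) => A B C; rewrite NE; field.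
Qed.

(** The factorials cancel in the ratio of consecutive weights, which is exact. *)
Lemma log_weight_step J h N k d : (k + 2 * d.+1)%N = N ->
  log_weight J h N k.+2 d - log_weight J h N k d.+1 =
  ln (1 - k%:R / N%:R) - ln (k%:R / N%:R + N%:R^-1) -
  ln (k%:R / N%:R + 2 * N%:R^-1) + 4 * J * (k%:R / N%:R + N%:R^-1) + 2 * (h - J).
Proof.
move=> kdN; have N0 : (0 < N)%N by lia.
have n0 : 0 < N%:R :> R by rewrite ltr0n.
have nn : N%:R != 0 :> R by rewrite gt_eqF.
have NE : k%:R = N%:R - 2 * d.+1%:R :> R by rewrite -kdN natrD natrM addrK.
have k1 : k%:R / N%:R + N%:R^-1 = k.+1%:R / N%:R :> R.
  by rewrite -natr1 mulrDl mul1r.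
have k2 : k%:R / N%:R + 2 * N%:R^-1 = k.+2%:R / N%:R :> R.
  by rewrite -addn2 natrD; ring.
have d1 : 1 - k%:R / N%:R = 2 * d.+1%:R / N%:R :> R.
  by rewrite NE; field.
rewrite d1 k2 {1}k1 !ln_div ?lnM ?posrE ?mulr_gt0 ?ltr0n//.
rewrite /log_weight !ln_factS.
have -> : k.+2%:R = k%:R + 2 :> R by rewrite -addn2 natrD.
have -> : d.+1%:R = d%:R + 1 :> R by rewrite -natr1.
by move: (ln _) (ln _) (ln _) (ln _) (ln _) => *; field; rewrite gt_eqF.
Qed.


Lemma ler_sqrD (z y c : R) : y ^+ 2 <= y ->
  2 * (z + c * y) ^+ 2 <= 4 * z ^+ 2 + 4 * c ^+ 2 * y.
Proof.
move=> yy; apply: (@le_trans _ _ (4 * z ^+ 2 + 4 * c ^+ 2 * y ^+ 2)).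
  by have := sqr_ge0 (z - c * y); lra.
by rewrite lerD2l ler_wpM2l// mulr_ge0// sqr_ge0.
Qed.

(** Minus the second derivative of [exponent] at [m]. *)
Definition curvature J m : R := (2 - m - 4 * J * m * (1 - m)) / (2 * m * (1 - m)).

(** At a fixed point [m] of [g \o tau] the logarithm of the ratio of consecutive
    weights vanishes to leading order; its slope there is [- 2 * curvature]. *)
Lemma log_ratio_linear J h m : 0 < m < 1 -> g (tau J h m) = m ->
  exists e C, [/\ 0 < e, 0 < C & forall x y, `|x - m| <= e -> 0 < y <= e ->
    `|ln (1 - x) - ln (x + y) - ln (x + 2 * y) + 4 * J * (x + y) + 2 * (h - J)
      + 2 * curvature J m * (x - m)| <= C * ((x - m) ^+ 2 + y)].
Proof.
move=> /andP[m0 m1] gm.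
have om0 : 0 < 1 - m by rewrite subr_gt0.
have mn : m != 0 by rewrite gt_eqF.
have omn : 1 - m != 0 by rewrite gt_eqF.
have critical : ln (1 - m) - 2 * ln m + 4 * J * m - 2 * J + 2 * h = 0.
  by have := ln_g (tau J h m); rewrite gm /tau; lra.
pose e : R := Num.min 1 (Num.min m (1 - m) / 6).
have e0 : 0 < e by rewrite !lt_min ltr01 divr_gt0// lt_min m0.
have [e1 [em eom]] : e <= 1 /\ 6 * e <= m /\ 6 * e <= 1 - m.
  have : e <= Num.min m (1 - m) / 6 by rewrite ge_min lexx orbT.
  rewrite ler_pdivlMr// le_min => /andP[? ?]; rewrite ge_min lexx; split => //.
  by split; lra.
pose C : R := 2 / (1 - m) ^+ 2 + 8 / m ^+ 2 + (40 / m ^+ 2 + 3 / m + 4 * `|J|).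
have [im0 [im2 iom2]] : 0 < m^-1 /\ 0 < (m ^+ 2)^-1 /\ 0 < ((1 - m) ^+ 2)^-1.
  by rewrite !invr_gt0 !exprn_gt0.
have J0 := normr_ge0 J.
have C0 : 0 < C by rewrite /C; lra.
exists e, C; split => // x y; set z := x - m => ze /andP[y0 ye].
have [zl zu] : - e <= z /\ z <= e by move: ze; rewrite ler_norml => /andP.
have xE : x = m + z by rewrite /z; ring.
have log1 : `|ln (1 - x) - ln (1 - m) + z / (1 - m)| <= 2 * (z / (1 - m)) ^+ 2.
  have -> : 1 - x = (1 - m) * (1 + - (z / (1 - m))).
    by rewrite xE; field.
  have small : `|- (z / (1 - m))| <= 2^-1.
    rewrite normrN normrM normfV (gtr0_norm om0) ler_pdivrMr//.
    by apply: (le_trans ze); lra.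
  have := ln1D_quadratic small; rewrite sqrrN => small2.
  rewrite lnM ?posrE//; last by move: small; rewrite ler_norml => /andP[? ?]; lra.
  by move: small2; rewrite opprK [ln (1 - m) + _]addrC addrK.
have log2 w : 0 <= w <= 2 * e -> `|ln (x + w) - ln m - (z + w) / m| <= 2 * ((z + w) / m) ^+ 2.
  move=> /andP[w0 we].
  have -> : x + w = m * (1 + (z + w) / m) by rewrite xE; field.
  have small : `|(z + w) / m| <= 2^-1.
    rewrite normrM normfV (gtr0_norm m0) ler_pdivrMr//.
    by rewrite ler_norml; apply/andP; split; lra.
  rewrite lnM ?posrE//; last by move: small; rewrite ler_norml => /andP[? ?]; lra.
  by rewrite [_ + ln _]addrC addrK; exact: ln1D_quadratic.
have l1 := log2 y (ltac:(by apply/andP; split; lra)).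
have l2 := log2 (2 * y) (ltac:(by apply/andP; split; lra)).
have -> : ln (1 - x) - ln (x + y) - ln (x + 2 * y) + 4 * J * (x + y) + 2 * (h - J)
      + 2 * curvature J m * z =
  (ln (1 - x) - ln (1 - m) + z / (1 - m)) - (ln (x + y) - ln m - (z + y) / m)
  - (ln (x + 2 * y) - ln m - (z + 2 * y) / m) + (4 * J * y - 3 / m * y).
  move: critical; move: (ln _) (ln _) (ln _) (ln _) (ln _) => L1 L2 L3 L4 L5 cr.
  have -> : L5 = 2 * L4 - 4 * J * m + 2 * J - 2 * h by lra.
  rewrite /curvature xE; field. by rewrite omn mn.
have tri (a b c d : R) : `|a - b - c + d| <= `|a| + `|b| + `|c| + `|d|.
  by rewrite (le_trans (ler_normD _ _))// lerD2r (le_trans (ler_normB _ _))// lerD2r ler_normB.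
apply: (le_trans (tri _ _ _ _)).
have l3 : `|4 * J * y - 3 / m * y| <= (4 * `|J| + 3 / m) * y.
  apply: (le_trans (ler_normB _ _)); rewrite !normrM !normfV (gtr0_norm y0) (gtr0_norm m0).
  by rewrite !normr_nat; lra.
apply: (le_trans (lerD (lerD (lerD log1 l1) l2) l3)).
have yy : y ^+ 2 <= y by rewrite expr2 ler_piMl ?(ltW y0)// (le_trans ye).
have s1 : 2 * ((z + y) / m) ^+ 2 <= (m ^+ 2)^-1 * (4 * z ^+ 2 + 4 * y).
  rewrite expr_div_n mulrA mulrC ler_pM2l//.
  by have := @ler_sqrD z y 1 yy; rewrite mul1r expr1n !mulr1.
have s2 : 2 * ((z + 2 * y) / m) ^+ 2 <= (m ^+ 2)^-1 * (4 * z ^+ 2 + 16 * y).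
  rewrite expr_div_n mulrA mulrC ler_pM2l//.
  by have := @ler_sqrD z y 2 yy; rewrite (_ : 4 * 2 ^+ 2 = 16 :> R)//; ring.
have s3 : 2 * (z / (1 - m)) ^+ 2 = ((1 - m) ^+ 2)^-1 * (2 * z ^+ 2) by field.
rewrite s3; move: s1 s2; rewrite /C; have z2 := sqr_ge0 z.
have t1 : 0 <= (m ^+ 2)^-1 * y by rewrite mulr_ge0 ?ltW.
have t2 : 0 <= ((1 - m) ^+ 2)^-1 * y by rewrite mulr_ge0 ?ltW.
have t3 : 0 <= (m^-1) * z ^+ 2 by rewrite mulr_ge0 ?(ltW im0).
have t4 : 0 <= `|J| * z ^+ 2 by rewrite mulr_ge0.
have t5 : 0 <= (m ^+ 2)^-1 * z ^+ 2 by rewrite mulr_ge0 ?(ltW im2).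
by lra.
Qed.

End log_weight.

(** * The local limit estimate *)

Section local_estimate.
Context {R : realType}.
Implicit Types (J h m t y : R) (N k d p n i : nat).

Lemma ler_dist_steps (f : nat -> R) (B : R) i j : (i <= j)%N ->
  (forall l, (i <= l < j)%N -> `|f l.+1 - f l| <= B) ->
  `|f j - f i| <= (j%:R - i%:R) * B.
Proof.
elim: j => [|j IH]; first by rewrite leqn0 => /eqP -> _; rewrite !subrr normr0 mul0r.
rewrite leq_eqVlt => /predU1P[-> _|ij H]; first by rewrite !subrr normr0 mul0r.
have -> : f j.+1 - f i = (f j.+1 - f j) + (f j - f i) by ring.
rewrite (le_trans (ler_normD _ _))//.
have -> : (j.+1%:R - i%:R) * B = B + (j%:R - i%:R) * B by rewrite -natr1; ring.
rewrite lerD//; first by apply: H; rewrite -ltnS ij /=.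
by apply: IH => // l /andP[il lj]; apply: H; rewrite il ltnS ltnW.
Qed.

(** The monomer number has the parity of [N]: with [N = p + 2 n] and [p <= 1] it
    is [p + 2 i], and then there are [n - i] dimers. *)
Definition chain_weight J h p n i : R := log_weight J h (p + 2 * n) (p + 2 * i) (n - i).

Lemma step_count_le (r a : R) : 1 <= r -> 0 <= a -> r * a + 2 <= (1 + a) * r * 2.
Proof. by move=> r1 a0; have : 0 <= r * a by [rewrite mulr_ge0//; lra]; lra. Qed.

Lemma ler_dist_between (x y z m e : R) : x <= y <= z ->
  `|x - m| <= e -> `|z - m| <= e -> `|y - m| <= e.
Proof.
move=> /andP[xy yz]; rewrite !ler_norml => /andP[xl _] /andP[_ zu].
by apply/andP; split; lra.
Qed.

Lemma chain_weight_step J h p n j (N := (p + 2 * n)%:R : R)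
    (x := (p + 2 * j)%:R / N : R) : (j < n)%N ->
  chain_weight J h p n j.+1 - chain_weight J h p n j =
  ln (1 - x) - ln (x + N^-1) - ln (x + 2 * N^-1) + 4 * J * (x + N^-1) + 2 * (h - J).
Proof.
move=> jn; rewrite /x /N -(@log_weight_step R J h (p + 2 * n) (p + 2 * j) (n - j.+1)).
  rewrite /chain_weight; have -> : (p + 2 * j.+1 = (p + 2 * j).+2)%N by lia.
  by have -> : (n - j = (n - j.+1).+1)%N by lia.
lia.
Qed.

(** Summation of [log_ratio_linear] from [i0], the index of a lattice point next to
    [N m]: over the [O(sqrt N * (1 + |t|))] steps the errors, of size
    [O((1 + t^2) / N)] each, add up to the right-hand side. *)
Lemma log_weight_gaussian J h m : 0 < m < 1 -> g (tau J h m) = m ->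
  0 < curvature J m ->
  exists e C, [/\ 0 < e, 0 < C & forall p n i i0 (N := (p + 2 * n)%:R : R)
    (t := ((p + 2 * i)%:R - N * m) / Num.sqrt N),
    (0 < p + 2 * n)%N -> 2 / N <= e -> (i <= n)%N -> (i0 <= n)%N ->
    `|(p + 2 * i0)%:R - N * m| <= 2 -> `|(p + 2 * i)%:R / N - m| <= e ->
    `|chain_weight J h p n i - chain_weight J h p n i0 + curvature J m * t ^+ 2 / 2|
      <= C * ((1 + `|t|) * (1 + t ^+ 2)) / Num.sqrt N].
Proof.
move=> m01 gm.
have [e0 [C0 [e00 C00]]] := log_ratio_linear m01 gm.
move: (curvature J m) => ka HC ka0.
exists (e0 / 2), (9 * (C0 + 2 * ka) + 2 * ka); split.
- by rewrite divr_gt0.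
- by lra.
move=> p n i i0 N t; set k := fun j => (p + 2 * j)%:R : R.
rewrite -/(k i) -/(k i0) => N0 Ne i_n i0_n k0 xe.
have n0 : 0 < N by rewrite ltr0n.
have n1 : 1 <= N by rewrite ler1n.
have nn : N != 0 by rewrite gt_eqF.
pose y := `|k i / N - m|.
(* [D] is the log-weight with its quadratic profile removed *)
pose D j := chain_weight J h p n j + ka * (k j - N * m) ^+ 2 / (2 * N).
pose B := (C0 + 2 * ka) * ((y + 2 / N) ^+ 2 + N^-1).
have kS j : k j.+1 = k j + 2 by rewrite /k mulnS addnCA natrD addrC.
have kmono a b : (a <= b)%N -> k a <= k b by move=> ab; rewrite ler_nat leq_add2l leq_mul2l.
have stepD j : (j < n)%N -> `|k j / N - m| <= y + 2 / N -> `|D j.+1 - D j| <= B.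
  move=> jn yj.
  have -> : D j.+1 - D j = ln (1 - k j / N) - ln (k j / N + N^-1) -
     ln (k j / N + 2 * N^-1) + 4 * J * (k j / N + N^-1) + 2 * (h - J) +
     2 * ka * (k j / N - m) + 2 * ka * N^-1.
    rewrite -/N -(chain_weight_step J h p jn) /D kS.
    by move: (chain_weight _ _ _ _ _) (chain_weight _ _ _ _ _) => A1 A2; field;
      rewrite -natrM -natrD.
  apply: (le_trans (ler_normD _ _)).
  have iN0 : 0 < N^-1 by rewrite invr_gt0.
  have zle : `|k j / N - m| <= e0 by apply: (le_trans yj); rewrite /y; lra.
  have inle : 0 < N^-1 <= e0 by rewrite iN0/=; lra.
  have := HC _ _ zle inle; rewrite (ger0_norm (_ : 0 <= 2 * ka * N^-1)); last first.
    by apply: mulr_ge0; [apply: mulr_ge0; [exact: ler0n|exact: ltW]|exact: ltW].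
  move=> le1; have sq : (k j / N - m) ^+ 2 <= (y + 2 / N) ^+ 2.
    rewrite -(real_normK (num_real (k j / N - m))) lerXn2r ?nnegrE ?normr_ge0//.
    by apply: le_trans yj.
  apply: (le_trans (lerD le1 (lexx _))).
  have : C0 * (k j / N - m) ^+ 2 <= C0 * (y + 2 / N) ^+ 2 by rewrite ler_pM2l.
  have : 0 <= ka * (y + 2 / N) ^+ 2 by rewrite mulr_ge0 ?sqr_ge0// ltW.
  by rewrite /B; lra.
have y0 : 0 <= y by rewrite /y.
have k0N : `|k i0 / N - m| <= 2 / N.
  have -> : k i0 / N - m = (k i0 - N * m) / N by rewrite mulrBl (mulrC N) mulfK.
  by rewrite normrM normfV (gtr0_norm n0) ler_pM2r// invr_gt0.
have B0 : 0 <= B by apply: mulr_ge0; [lra|rewrite addr_ge0 ?sqr_ge0 ?invr_ge0 ?(ltW n0)].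
have iN0 : 0 < N^-1 by rewrite invr_gt0.
have between j : (i <= j <= i0)%N || (i0 <= j <= i)%N -> `|k j / N - m| <= y + 2 / N.
  have kN c d : (c <= d)%N -> k c / N <= k d / N by move=> /kmono; rewrite ler_pM2r.
  have yi : `|k i / N - m| <= y + 2 / N by rewrite lerDl divr_ge0// ltW.
  have yi0 : `|k i0 / N - m| <= y + 2 / N by rewrite (le_trans k0N)// lerDr.
  by move=> /orP[]/andP[/kN b1 /kN b2]; [apply: ler_dist_between yi yi0|
    apply: ler_dist_between yi0 yi]; rewrite b1.
have Dle : `|D i - D i0| <= `|k i - k i0| / 2 * B.
  have kd a b : (k a - k b) / 2 = a%:R - b%:R.
    by rewrite /k !(natrD _ p) !natrM; field.
  have [ii0|i0i] := leqP i i0.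
    rewrite distrC (distrC (k i)) (ger0_norm (_ : 0 <= k i0 - k i)) ?subr_ge0 ?kmono// kd.
    apply: ler_dist_steps => // l /andP[il li]; apply: stepD; first exact: leq_trans i0_n.
    by apply: between; rewrite il ltnW.
  rewrite (ger0_norm (_ : 0 <= k i - k i0)) ?subr_ge0 ?kmono 1?ltnW// kd.
  apply: ler_dist_steps => //; first exact: ltnW.
  move=> l /andP[il li]; apply: stepD; first exact: leq_trans i_n.
  by apply: between; rewrite il (ltnW li) orbT.
set r := Num.sqrt N in t *; set a := `|t|.
have rr : r ^+ 2 = N by rewrite sqr_sqrtr// ltW.
have r0 : 0 < r by rewrite sqrtr_gt0.
have r1 : 1 <= r by rewrite -sqrtr1 ler_wsqrtr.
have rn : r != 0 by rewrite gt_eqF.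
have a0 : 0 <= a by exact: normr_ge0.
have tE : k i - N * m = t * r by rewrite /t divfK.
have yE : y = a / r.
  have -> : y = `|(k i - N * m) / N| by rewrite mulrBl (mulrC N) mulfK.
  rewrite tE -rr expr2 invfM mulrA mulfK// normrM normfV (gtr0_norm r0) //.
have tt : t ^+ 2 = a ^+ 2 by rewrite real_normK// num_real.
have kk : `|k i - k i0| <= r * a + 2.
  have -> : k i - k i0 = (k i - N * m) - (k i0 - N * m) by ring.
  by rewrite (le_trans (ler_normB _ _))// lerD// tE normrM (gtr0_norm r0) mulrC.
have Ble : B <= 9 * (C0 + 2 * ka) * (1 + a ^+ 2) / r ^+ 2.
  rewrite /B yE -rr.
  have -> : (a / r + 2 / r ^+ 2) ^+ 2 + (r ^+ 2)^-1 = ((a + 2 / r) ^+ 2 + 1) / r ^+ 2.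
    by field.
  rewrite [leLHS]mulrA ler_pM2r ?invr_gt0 ?exprn_gt0//.
  have -> : 9 * (C0 + 2 * ka) * (1 + a ^+ 2) = (C0 + 2 * ka) * (9 * (1 + a ^+ 2)) by ring.
  rewrite ler_pM2l; last by lra.
  have : (a + 2 / r) ^+ 2 <= (a + 2) ^+ 2.
    have r2 : 2 / r <= 2 by rewrite ler_pdivrMr// ler_peMr.
    have r20 : 0 <= 2 / r by rewrite divr_ge0// ltW.
    by rewrite lerXn2r ?nnegrE ?lerD2l// addr_ge0.
  by have := sqr_ge0 (a - 1); have := sqr_ge0 a; lra.
have -> : chain_weight J h p n i - chain_weight J h p n i0 + ka * t ^+ 2 / 2 =
    (D i - D i0) + ka * (k i0 - N * m) ^+ 2 / (2 * N).
  by rewrite /D tE -rr; field.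
apply: (le_trans (ler_normD _ _)).
have q0 : `|ka * (k i0 - N * m) ^+ 2 / (2 * N)| <= 2 * ka / r ^+ 2.
  have k4 : (k i0 - N * m) ^+ 2 <= 2 ^+ 2.
    by rewrite -(real_normK (num_real (_ - _))) lerXn2r ?nnegrE.
  have c0 : 0 < ka / (2 * N) by rewrite divr_gt0// mulr_gt0.
  have -> : ka * (k i0 - N * m) ^+ 2 / (2 * N) = ka / (2 * N) * (k i0 - N * m) ^+ 2 by ring.
  rewrite (ger0_norm (mulr_ge0 (ltW c0) (sqr_ge0 _))).
  apply: (@le_trans _ _ (ka / (2 * N) * 2 ^+ 2)); first by rewrite ler_pM2l.
  by rewrite -rr le_eqVlt; apply/predU1P; left; field.
have d1 : `|D i - D i0| <= (1 + a) * r * (9 * (C0 + 2 * ka) * (1 + a ^+ 2) / r ^+ 2).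
  apply: (le_trans Dle); rewrite ler_pM ?divr_ge0// ler_pdivrMr//.
  by apply: (le_trans kk); exact: step_count_le.
apply: (le_trans (lerD d1 q0)).
have q1 : 2 * ka / r ^+ 2 <= 2 * ka * ((1 + a) * (1 + a ^+ 2)) / r.
  have -> : 2 * ka / r ^+ 2 = 2 * ka * r^-1 / r by field.
  rewrite ler_pM2r ?invr_gt0// ler_pM2l ?mulr_gt0//.
  apply: (@le_trans _ _ 1); first by rewrite invf_le1.
  by rewrite -[leLHS]mulr1 ler_pM// lerDl ?sqr_ge0.
apply: (le_trans (lerD (lexx _) q1)); rewrite tt le_eqVlt; apply/predU1P; left.
by field.
Qed.

(** The cubic error is harmless: near [m] it is dominated by half of the
    quadratic exponent, and a Gaussian kills every polynomial. *)
Lemma expR_gaussian_error (ka C : R) : 0 < ka -> 0 < C ->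
  exists2 K, 0 < K & forall r t x : R, 0 < r ->
    `|x + ka * t ^+ 2 / 2| <= C * ((1 + `|t|) * (1 + t ^+ 2)) / r ->
    C * (1 + `|t|) / r <= ka / 4 ->
    `|expR x - expR (- (ka * t ^+ 2 / 2))| <= K / (r * (1 + t ^+ 2)).
Proof.
move=> ka0 C0; have c0 : 0 < ka / 4 by rewrite divr_gt0.
have [C3 C30 HC3] := @poly_gauss_bounded R (ka / 4) 2 c0.
exists (2 * C * expR (ka / 4) * C3); first by rewrite !mulr_gt0 ?expR_gt0.
move=> r t x r0 err dom; set q := 1 + t ^+ 2 in err *.
have q0 : 0 < q by rewrite ltr_wpDr// sqr_ge0.
have half : C * ((1 + `|t|) * q) / r <= ka / 4 * q.
  by rewrite mulrA mulrAC ler_pM2r.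
set M := ka / 4 - ka / 4 * t ^+ 2.
have xM : x <= M.
  have := ler_normlW err; rewrite /M; move: half; rewrite /q; lra.
have gM : - (ka * t ^+ 2 / 2) <= M.
  have : 0 <= ka * t ^+ 2 by rewrite mulr_ge0 ?sqr_ge0// ltW.
  by rewrite /M; lra.
apply: (le_trans (ler_dist_expR xM gM)); rewrite opprK.
have tq : 1 + `|t| <= 2 * q.
  rewrite /q -(real_normK (num_real t)); have := sqr_ge0 (`|t| - 1); nra.
have e1 : `|x + ka * t ^+ 2 / 2| <= 2 * C * q ^+ 2 / r.
  apply: (le_trans err); rewrite ler_pM2r ?invr_gt0//.
  have -> : 2 * C * q ^+ 2 = C * (2 * q * q) by ring.
  by rewrite ler_pM2l// ler_pM2r.
apply: (le_trans (ler_wpM2r (expR_ge0 _) e1)).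
rewrite /M expRD ler_pdivlMr ?mulr_gt0//.
have -> : 2 * C * q ^+ 2 / r * (expR (ka / 4) * expR (- (ka / 4 * t ^+ 2))) * (r * q) =
  2 * C * expR (ka / 4) * (q ^+ 3 * expR (- (ka / 4 * t ^+ 2))).
  by field; rewrite gt_eqF.
by rewrite ler_pM2l ?mulr_gt0 ?expR_gt0//; exact: HC3.
Qed.

Lemma continuous_exponent J h m : 0 < m < 1 -> {for m, continuous (exponent J h)}.
Proof.
move=> /andP[m0 m1]; have om0 : 0 < 1 - m by rewrite subr_gt0.
have cl : {for m, continuous (@ln R)} by exact: continuous_ln.
have c1 : {for m, continuous (fun x : R => 1 - x)}.
  by apply: continuousB; [exact: cvg_cst|exact: cvg_id].
have cl1 : {for m, continuous (fun x : R => ln (1 - x))}.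
  by apply: (@continuous_comp _ _ _ (fun x : R => 1 - x) (@ln R)) => //; exact: continuous_ln.
have ci : {for m, continuous (fun x : R => x)} by exact: cvg_id.
apply: continuousB; last exact: cvg_cst.
apply: continuousD; last by apply: continuousM => //; exact: cvg_cst.
apply: continuousB; last first.
  by apply: continuousM => //; apply: continuousM => //; exact: cvg_cst.
apply: continuousB; last exact: continuousM.
apply: continuousD; apply: continuousM => //; try exact: cvg_cst.
exact: exprn_continuous.
Qed.

End local_estimate.

Section far_from_the_peak.
Context {R : realType}.
Implicit Types (J h m t y : R) (N k d p n i : nat).

Lemma ler_dist_unit (x y : R) : 0 <= x -> x <= 1 -> 0 <= y -> y <= 1 ->
  `|x - y| <= 1.
Proof. by move=> *; rewrite ler_norml; apply/andP; split; lra. Qed.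

Lemma dist_in_window (a b m x : R) : a < m -> m < b ->
  `|x - m| <= (m - a) / 2 -> `|x - m| <= (b - m) / 2 -> a < x < b.
Proof.
move=> am mb; rewrite !ler_norml => /andP[xa _] /andP[_ xb].
by apply/andP; split; lra.
Qed.

Lemma le_ln_nat i j : (i <= j)%N -> (0 < j)%N -> ln (i%:R : R) <= ln j%:R.
Proof.
case: i => [_ j0|i ij j0]; first by rewrite ln0// ln_ge0// ler1n.
by rewrite ler_ln ?posrE ?ltr0n// ler_nat.
Qed.

(** Crude but global: Stirling's formula up to polynomial factors. *)
Lemma chain_weight_diff_le J h p n i i0 (N := (p + 2 * n)%:R : R) :
  (0 < p + 2 * n)%N -> (i <= n)%N -> (i0 <= n)%N ->
  chain_weight J h p n i - chain_weight J h p n i0 <=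
    N * (exponent J h ((p + 2 * i)%:R / N) - exponent J h ((p + 2 * i0)%:R / N)) +
    2 * (1 + ln N).
Proof.
move=> N0 i_n i0_n; rewrite /chain_weight !log_weight_exponent//; [|by lia|by lia].
have /andP[a1 _] := stirling_error_bounds (p + 2 * i) (R := R).
have /andP[a2 _] := stirling_error_bounds (n - i) (R := R).
have /andP[_ a3] := stirling_error_bounds (p + 2 * i0) (R := R).
have /andP[_ a4] := stirling_error_bounds (n - i0) (R := R).
have b3 : ln (p + 2 * i0)%:R <= ln N by apply: le_ln_nat; lia.
have b4 : ln (n - i0)%:R <= ln N by apply: le_ln_nat; lia.
rewrite -/N; lra.
Qed.

(** At distance of order [r = sqrt N] from the peak, the Gaussian and exponentially
    small weights ([expR_far]) are absorbed in the error term that governs the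
    central region. *)
Lemma gaussian_far (ka e : R) : 0 < ka -> 0 < e -> exists2 K, 0 < K &
  forall r t, 0 < r -> e * r < `|t| ->
    expR (- (ka * t ^+ 2 / 2)) <= K / (r * (1 + t ^+ 2)).
Proof.
move=> ka0 e0; have ka20 : 0 < ka / 2 by rewrite divr_gt0.
have [K K0 HK] := @poly_gauss_bounded R (ka / 2) 1 ka20.
exists (K / e); first by rewrite divr_gt0.
move=> r t r0 far; have t20 : 0 < 1 + t ^+ 2 by rewrite ltr_wpDr// sqr_ge0.
have := HK t; rewrite (_ : ka / 2 * t ^+ 2 = ka * t ^+ 2 / 2); last by ring.
move: (expR_ge0 (- (ka * t ^+ 2 / 2))); move: (expR _) => E E0 H.
rewrite ler_pdivlMr ?mulr_gt0// ler_pdivlMr//; apply: le_trans H.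
have -> : E * (r * (1 + t ^+ 2)) * e = (e * r) * ((1 + t ^+ 2) * E) by ring.
have -> : (1 + t ^+ 2) ^+ 2 * E = (1 + t ^+ 2) * ((1 + t ^+ 2) * E) by ring.
rewrite ler_wpM2r ?(mulr_ge0 (ltW t20))//.
apply: (le_trans (ltW far)); rewrite -(real_normK (num_real t)).
by have := sqr_ge0 (`|t| - 1); have := sqr_ge0 `|t|; lra.
Qed.

Lemma expR_far (c : R) : 0 < c -> exists2 K, 0 < K &
  forall r t x, 1 <= r -> t ^+ 2 <= r ^+ 2 ->
    x <= - (c * r ^+ 2) + 2 * (1 + ln (r ^+ 2)) ->
    expR x <= K / (r * (1 + t ^+ 2)).
Proof.
move=> c0; have [K K0 HK] := @poly_gauss_bounded R c 3 c0.
exists (expR 2 * K); first by rewrite mulr_gt0 ?expR_gt0.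
move=> r t x r1 tr xle; have r0 : 0 < r by exact: lt_le_trans r1.
have t20 : 0 < 1 + t ^+ 2 by rewrite ltr_wpDr// sqr_ge0.
have r20 : 0 < r ^+ 2 by rewrite exprn_gt0.
have : expR x <= expR (- (c * r ^+ 2)) * (expR 2 * (r ^+ 2) ^+ 2).
  have -> : (r ^+ 2) ^+ 2 = expR (2 * ln (r ^+ 2)) by rewrite expRM_natl lnK ?posrE.
  by rewrite -!expRD ler_expR; apply: (le_trans xle); lra.
have := HK r; have := expR_ge0 (- (c * r ^+ 2)); have := expR_gt0 (2 : R).
move: (expR (- _)) (expR 2) => E E2 E20 E0 H xE.
rewrite ler_pdivlMr ?mulr_gt0//.
have q1 : r * (1 + t ^+ 2) <= (1 + r ^+ 2) ^+ 2.
  rewrite expr2 ler_pM ?(ltW r0) ?(ltW t20) ?lerD2l//.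
  by have := sqr_ge0 (r - 1); lra.
have q2 : (r ^+ 2) ^+ 2 <= (1 + r ^+ 2) ^+ 2.
  by rewrite lerXn2r ?nnegrE ?lerDr ?addr_ge0 ?(ltW r20).
apply: (@le_trans _ _ (E * (E2 * (1 + r ^+ 2) ^+ 2) * (1 + r ^+ 2) ^+ 2)).
  apply: ler_pM; rewrite ?expR_ge0 ?(mulr_ge0 (ltW r0) (ltW t20))//.
  by apply: (le_trans xE); rewrite ler_wpM2l// ler_wpM2l// ltW.
have -> : E * (E2 * (1 + r ^+ 2) ^+ 2) * (1 + r ^+ 2) ^+ 2 =
  E2 * ((1 + r ^+ 2) ^+ 4 * E) by ring.
by rewrite ler_pM2l.
Qed.

Lemma exponent_near J h m c : 0 < m < 1 -> 0 < c ->
  exists2 d : R, 0 < d & forall x, `|x - m| <= d ->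
    exponent J h m - c <= exponent J h x.
Proof.
move=> m01 c0.
have /cvgrPdist_le /(_ _ c0) := @continuous_exponent R J h m m01.
move=> /nbhs_ballP[d /= d0 H]; exists (d / 2); first by rewrite divr_gt0.
move=> x xm; have /H : ball m d x.
  by rewrite /ball/= distrC (le_lt_trans xm)// ltr_pdivrMr// ltr_pMr// ltr1n.
by rewrite /= => /ler_normlW; lra.
Qed.

Lemma nearest_index p n (m : R) (N := (p + 2 * n)%:R : R) : (p <= 1)%N ->
  m <= 1 -> 2 <= N * m ->
  exists2 i0, (i0 <= n)%N & `|(p + 2 * i0)%:R - N * m| <= 2.
Proof.
move=> p1 m1; move NE : N => N'; move=> Nm2.
have p1R : p%:R <= 1 :> R by rewrite -[leRHS]/(1%:R) ler_nat.
have NmN : N' * m <= N' by rewrite ler_piMr// -NE.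
pose i0 := Num.truncn ((N' * m - p%:R) / 2).
have /andP[lo hi] : i0%:R <= (N' * m - p%:R) / 2 < i0.+1%:R.
  by apply: truncn_itv; rewrite divr_ge0//; lra.
exists i0.
  have NE' : N' = p%:R + 2 * n%:R by rewrite -NE /N natrD natrM.
  by rewrite -(ler_nat R); lra.
by move: hi; rewrite -[i0.+1%:R]natr1 natrD natrM ler_norml => hi; apply/andP; split; lra.
Qed.

(** Within [e2] of [m] the Gaussian approximation of the log-weights applies, and
    [e2] is so small that the cubic error is dominated; further away the two
    terms are small separately, the first because [exponent] stays below its
    maximum by some [c] on the window, whereas at the reference index [i0] it is
    within [c / 2] of the maximum. *)
Lemma local_estimate J h m a b : 0 < m < 1 -> g (tau J h m) = m ->
  0 < curvature J m -> a < m < b ->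
  (forall x : R, 0 <= x <= 1 -> a <= x <= b -> x != m -> ptilde J h x < ptilde J h m) ->
  exists e C, [/\ 0 < e, 0 < C & forall p n (N := (p + 2 * n)%:R : R),
    (p <= 1)%N -> (0 < p + 2 * n)%N -> 2 / N <= e ->
    exists i0, forall i (x := (p + 2 * i)%:R / N)
      (t := ((p + 2 * i)%:R - N * m) / Num.sqrt N), (i <= n)%N ->
      `|(if a < x < b then expR (chain_weight J h p n i - chain_weight J h p n i0)
         else 0) - expR (- (curvature J m * t ^+ 2 / 2))|
        <= C / (Num.sqrt N * (1 + t ^+ 2))].
Proof.
move=> m01 gm ka0 /andP[am mb] win; have /andP[m0 m1] := m01.
have [e1 [C1 [e10 C10]]] := log_weight_gaussian m01 gm ka0.
move: (curvature J m) ka0 => ka ka0 gauss.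
have [K1 K10 expo] := expR_gaussian_error ka0 C10.
have kC0 : 0 < ka / (8 * C1) by rewrite divr_gt0 ?mulr_gt0.
(* [ka / (8 * C1)] makes the cubic error at most half of the quadratic exponent,
   and the last two bounds keep the central region inside the window *)
pose e2 := Num.min (Num.min e1 (ka / (8 * C1))) (Num.min ((m - a) / 2) ((b - m) / 2)).
have e20 : 0 < e2.
  by rewrite !lt_min e10 kC0 !divr_gt0 ?subr_gt0.
have [c c0 gap] := window_gap e20 win.
have c20 : 0 < c / 2 by rewrite divr_gt0.
have [d d0 cont] := exponent_near J h m01 c20.
have [K2 K20 tail] := expR_far c20.
have [K3 K30 gtail] := gaussian_far ka0 e20.
pose e := Num.min (Num.min e1 (2 * (ka / (8 * C1)) ^+ 2)) (Num.min d m).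
exists e, (K1 + (K2 + K3)).
split.
- by rewrite !lt_min e10 d0 m0 (mulr_gt0 _ (exprn_gt0 2 kC0)).
- by rewrite !addr_gt0.
move=> p n N p1 pn0; rewrite !le_min => /andP[/andP[Ne1 Ne2] /andP[Nd Nm]].
have n0 : 0 < N by rewrite ltr0n.
have n1 : 1 <= N by rewrite ler1n.
have nn : N != 0 by rewrite gt_eqF.
have Nm2 : 2 <= N * m by move: Nm; rewrite ler_pdivrMr// mulrC.
have [i0 i0n k0] := nearest_index p1 (ltW m1) Nm2.
exists i0 => i x t i_n.
(* abstract the lattice away: only real numbers matter from here on *)
have diff := chain_weight_diff_le J h pn0 i_n i0n.
have mid := gauss p n i i0 pn0 Ne1 i_n i0n k0.
have kN : (p + 2 * i)%:R <= N.
  by rewrite ler_nat leq_add2l leq_mul2l.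
move: kN diff mid; rewrite -/N -/x -/t.
have x0 : 0 <= x by rewrite divr_ge0.
have k0' : `|(p + 2 * i0)%:R / N - m| <= d.
  have -> : (p + 2 * i0)%:R / N - m = ((p + 2 * i0)%:R - N * m) / N.
    by rewrite mulrBl (mulrC N) mulfK.
  by rewrite normrM normfV (gtr0_norm n0) (le_trans _ Nd)// ler_pM2r ?invr_gt0.
move: (cont _ k0') x0; rewrite /x /t {x t}.
move: (chain_weight _ _ _ _ _) (chain_weight _ _ _ _ _) => w w0.
move: {k0 k0'} ((p + 2 * i0)%:R / N) => y0.
move: ((p + 2 * i)%:R) => k.
move: N n0 n1 nn Ne1 Ne2 Nd Nm Nm2 => N n0 n1 nn Ne1 Ne2 Nd Nm Nm2 {cont gauss}.
set x := k / N => conty0 x0 kN diff.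
move rE : (Num.sqrt N) => r.
have rr : r ^+ 2 = N by rewrite -rE sqr_sqrtr// ltW.
have r0 : 0 < r by rewrite -rE sqrtr_gt0.
have r1 : 1 <= r by rewrite -rE -sqrtr1 ler_wsqrtr.
have rn : r != 0 by rewrite gt_eqF.
set t := (k - N * m) / r => mid.
have t20 : 0 < 1 + t ^+ 2 by rewrite ltr_wpDr// sqr_ge0.
have xm : x - m = t / r.
  by rewrite /t -mulrA -invfM -expr2 rr mulrBl (mulrC N) mulfK.
have xmn : `|x - m| = `|t| / r by rewrite xm normrM normfV (gtr0_norm r0).
have x1 : x <= 1 by rewrite ler_pdivrMr// mul1r.
have w20 : 0 < (r * (1 + t ^+ 2))^-1 by rewrite invr_gt0 mulr_gt0.
have [near|far] := leP `|x - m| e2.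
  move: near; rewrite !le_min => /andP[/andP[xe1 xka] /andP[xa xb]].
  have -> : a < x < b by exact: dist_in_window am mb xa xb.
  apply: (@le_trans _ _ (K1 / (r * (1 + t ^+ 2)))); last first.
    by rewrite ler_pM2r// lerDl ltW// addr_gt0.
  apply: expo => //; first exact: mid.
  have ir : r^-1 <= ka / (8 * C1).
    have : r^-1 ^+ 2 <= (ka / (8 * C1)) ^+ 2 by rewrite exprVn rr -(ler_pM2l (ltr0Sn R 1)).
    by rewrite ler_pXn2r// nnegrE ?invr_ge0 ?(ltW r0) ?(ltW kC0).
  move: xka; rewrite xmn => xka.
  have -> : C1 * (1 + `|t|) / r = C1 * (r^-1 + `|t| / r) by ring.
  have -> : ka / 4 = C1 * (ka / (8 * C1) + ka / (8 * C1)) by field; rewrite gt_eqF.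
  by rewrite ler_pM2l// lerD.
have tfar : e2 * r < `|t| by move: far; rewrite xmn ltr_pdivlMr.
have G := gtail _ _ r0 tfar.
apply: (@le_trans _ _ ((K2 + K3) / (r * (1 + t ^+ 2)))); last first.
  by rewrite ler_pM2r// lerDr ltW.
rewrite mulrDl; apply: (le_trans (ler_normB _ _)).
rewrite [X in _ + X]ger0_norm ?expR_ge0//; apply: lerD => //.
case: ifPn => [/andP[ax xb]|_]; last by rewrite normr0 mulr_ge0 ?ltW.
rewrite ger0_norm ?expR_ge0//; apply: tail => //.
  have := ler_dist_unit x0 x1 (ltW m0) (ltW m1).
  rewrite xmn ler_pdivrMr// mul1r -(real_normK (num_real t)) => ?.
  by rewrite lerXn2r ?nnegrE// ltW.
apply: (le_trans diff); rewrite rr lerD2r.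
have x01 : 0 <= x <= 1 by rewrite x0.
have axb : a <= x <= b by rewrite !ltW.
have f1 := exponent_le_ptilde_diag J h x01.
have := gap _ x01 axb (ltW far); rewrite -(exponent_fixed gm) => f2.
have -> : - (c / 2 * N) = N * (- (c / 2)) by ring.
rewrite ler_pM2l// lerBlDr (le_trans f1)// (le_trans f2)//.
have -> : exponent J h m - c = - (c / 2) + (exponent J h m - c / 2) by field.
by rewrite lerD2l.
Qed.

End far_from_the_peak.

(** * The conditional law of the monomer number *)

Section reduction.
Context {R : realType}.
Implicit Types (J h m z a b : R) (N d i : nat).

(** The energy depends on the configuration only through its number of
    monomers. *)
Lemma expR_hamiltonian J h N (D : {set {set 'I_N}}) : (0 < N)%N ->
  D \in dimers N ->
  #|matchings N #|D| |%:R * expR (- hamiltonian J h D) =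
    expR (log_weight J h N #|monomers D| #|D|).
Proof.
move=> N0 DN; have kdN := card_monomers DN.
have n0 : N%:R != 0 :> R by rewrite pnatr_eq0 -lt0n.
have -> : - hamiltonian J h D = #|monomers D|%:R / 2 * ln N%:R +
    J * #|monomers D|%:R ^+ 2 / N%:R + (h - J) * #|monomers D|%:R.
  by rewrite /hamiltonian /density; field.
have := @card_matchings N #|D| (ltac:(lia)).
have -> : (N - 2 * #|D| = #|monomers D|)%N by lia.
move=> /(congr1 (fun j => j%:R : R)); rewrite !natrM natrX.
move: (#|matchings N #|D| |%:R) (ler0n R #|matchings N #|D| |) => c c0 cE.
have f0 j : 0 < j`!%:R :> R by rewrite ltr0n fact_gt0.
have cp : 0 < c.
  by rewrite lt_def c0 andbT; apply: contraTneq (f0 N) => c00; rewrite -cE c00 mul0r ltxx.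
have : ln c + (ln ((#|monomers D|)`!%:R) + ln ((#|D|)`!%:R) + ln 2 *+ #|D|) = ln (N`!%:R).
  by rewrite -cE !lnM ?posrE ?mulr_gt0 ?exprn_gt0// lnXn.
have cK : expR (ln c) = c by rewrite lnK ?posrE.
rewrite -[ln 2 *+ _]mulr_natl => lc; rewrite -[X in X * _]cK -expRD /log_weight -lc.
by congr (expR _); ring.
Qed.

(** Grouping the configurations by their number of dimers. *)
Lemma sum_dimers_by_count J h p n (Q : pred nat) : (0 < p + 2 * n)%N -> (p <= 1)%N ->
  \sum_(D in dimers (p + 2 * n) | Q #|monomers D|) expR (- hamiltonian J h D) =
  \sum_(i < n.+1 | Q (p + 2 * i)%N) expR (chain_weight J h p n i).
Proof.
move=> N0 p1; set N := (p + 2 * n)%N.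
have dn (D : {set {set 'I_N}}) : D \in dimers N -> (n - #|D| < n.+1)%N.
  by move=> _; rewrite ltnS leq_subr.
have kE (D : {set {set 'I_N}}) : D \in dimers N ->
    (#|monomers D| = p + 2 * (n - #|D|))%N /\ (#|D| <= n)%N.
  by move=> /card_monomers; rewrite /N; lia.
rewrite (partition_big (fun D : {set {set 'I_N}} => inord (n - #|D|) : 'I_n.+1)
   (fun i : 'I_n.+1 => Q (p + 2 * i)%N))/=; last first.
  move=> D /andP[DN QD]; rewrite inordK ?dn//.
  by have [<-] := kE _ DN.
apply: eq_bigr => i Qi.
have i_n : (i <= n)%N by rewrite -ltnS.
have [D0 D0M|M0] := pickP (mem (matchings N (n - i))); last first.
  have := @card_matchings N (n - i) (ltac:(lia)); rewrite (eq_card0 M0) mul0n.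
  by move=> /esym/eqP; rewrite eqn0Ngt fact_gt0.
have := D0M; rewrite /= mem_matchings => /andP[D0N /eqP D0d].
have [k0E _] := kE _ D0N.
have wE : expR (chain_weight J h p n i) = #|matchings N (n - i)|%:R * expR (- hamiltonian J h D0).
  by rewrite -D0d expR_hamiltonian// k0E D0d subKn.
rewrite wE mulr_natl -sumr_const; apply: eq_big => D.
  rewrite mem_matchings; case DN : (D \in dimers N) => //=.
  have [-> Dn] := kE _ DN.
  apply/andP/eqP => [[_ /eqP/(congr1 val)]|Dd]; rewrite /= ?inordK ?ltnS ?leq_subr//.
    by move=> <-; rewrite subKn.
  split; last by apply/eqP/val_inj; rewrite /= inordK ?ltnS ?leq_subr// Dd subKn.
  by rewrite Dd subKn.
move=> /andP[/andP[DN _] /eqP /(congr1 val)]; rewrite /= inordK ?ltnS ?leq_subr// => e.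
have [kD Dn] := kE _ DN; congr expR; rewrite /hamiltonian /density kD k0E D0d e.
by rewrite subKn.
Qed.

Lemma prob_sum J h N (A : {set {set {set 'I_N}}}) :
  prob J h A = (\sum_(D in dimers N | D \in A) expR (- hamiltonian J h D)) /
    partition_function J h N.
Proof. by rewrite /prob mulr_suml. Qed.

Definition window a b N : {set {set {set 'I_N}}} :=
  [set D in dimers N | a < density R D < b]%SET.

Definition in_window a b N k := a < (k%:R / N%:R : R) < b.

Definition below m z N k := ((k%:R - N%:R * m) / Num.sqrt N%:R : R) <= z.

Lemma sum_window_gt0 J h a b p n (N := (p + 2 * n)%N) :
  (0 < N)%N -> (p <= 1)%N -> 0 < prob J h (window a b N) ->
  0 < \sum_(i < n.+1 | in_window a b N (p + 2 * i)) expR (chain_weight J h p n i).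
Proof.
move=> N0 p1; rewrite prob_sum => Z0.
rewrite -(sum_dimers_by_count J h (in_window a b N))//.
rewrite lt_def sumr_ge0 ?andbT; last by move=> *; exact: expR_ge0.
apply: contraTneq Z0 => Y0; rewrite -leNgt.
rewrite (eq_bigl (fun D => (D \in dimers N) && in_window a b N #|monomers D|)).
  by rewrite Y0 mul0r.
by move=> D; rewrite [in D \in window _ _ _]inE; case: (D \in dimers N).
Qed.

Lemma cond_prob_window J h a b m z p n (N := (p + 2 * n)%N) :
  (0 < N)%N -> (p <= 1)%N -> 0 < prob J h (window a b N) ->
  cond_prob J h (rescaled_le m N z) (window a b N) =
  (\sum_(i < n.+1 | below m z N (p + 2 * i) && in_window a b N (p + 2 * i))
     expR (chain_weight J h p n i)) /
  (\sum_(i < n.+1 | in_window a b N (p + 2 * i)) expR (chain_weight J h p n i)).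
Proof.
move=> N0 p1; rewrite /cond_prob !prob_sum => Z0.
have Zn : partition_function J h N != 0.
  by apply: contraTneq Z0 => ->; rewrite invr0 mulr0 ltxx.
rewrite invfM invrK mulrACA mulVf// mulr1.
rewrite -(sum_dimers_by_count J h (fun k => below m z N k && in_window a b N k))//.
rewrite -(sum_dimers_by_count J h (in_window a b N))//.
have inW D : (D \in window a b N) =
    (D \in dimers N) && in_window a b N #|monomers D| by rewrite inE.
have inB D : (D \in rescaled_le m N z) =
    (D \in dimers N) && below m z N #|monomers D| by rewrite inE.
congr (_ / _); apply: eq_bigl => D.
  by rewrite finset.in_setI inW inB; case: (D \in dimers N).
by rewrite inW; case: (D \in dimers N).
Qed.

Lemma ler_div_add3 (r x y u : R) : 0 < r -> 0 <= x -> 0 <= y -> 0 <= u ->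
  [/\ x / r <= (x + y + u) / r, y / r <= (x + y + u) / r & u / r <= (x + y + u) / r].
Proof. by move=> r0 *; rewrite !ler_pM2r ?invr_gt0//; split; lra. Qed.

(** The constant [2 * s] bounds the mass of one cell, [C2 / l] the two tails beyond
    the lattice, and [12 * A] the accumulated local errors, all times [1 / r]. *)
Lemma lattice_sums_near_normal (v l C : R) : 0 < v -> 0 < l -> 0 < C ->
  exists2 K : R, 0 < K & forall (t w : nat -> R) n r, 2 <= r ->
    (forall i, t i.+1 = t i + 2 / r) -> (forall i, 0 <= w i) ->
    (forall i, (i <= n)%N ->
      `|w i - expR (- t i ^+ 2 / (2 * v))| <= C / (r * (1 + t i ^+ 2))) ->
    l * r <= - t 0%N -> l * r <= t n.+1 -> 0 < \sum_(i < n.+1) w i ->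
    forall z, `|(\sum_(i < n.+1 | t i <= z) w i) / (\sum_(i < n.+1) w i) -
      centered_normal_cdf v z| <= K / r.
Proof.
move=> v0 l0 C0; set Phi := centered_normal_cdf v.
set s := normal_height v; have s0 : 0 < s := normal_height_gt0 v0.
have [C1 C10 cell] := normal_cdf_cell v0.
have [C2 C20 tails] := normal_cdf_tails v0.
have Phi01 := @normal_cdf_bounded R v.
have Phim := @normal_cdf_homo R v.
pose A := s * C + 2 * C1.
have A0 : 0 < A by rewrite addr_gt0 ?mulr_gt0.
have B0 : 0 < C2 / l by rewrite divr_gt0.
exists (7 * (2 * s + C2 / l + 12 * A)); first by lra.
move=> t w n r r2 tS w0 err t0 tn W0 z.
have r0 : 0 < r by lra.
have rn : r != 0 by rewrite gt_eqF.
have ir0 : 0 < r^-1 by rewrite invr_gt0.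
have h0 : 0 < 2 / r by rewrite divr_gt0.
have h1 : 2 / r <= 1 by rewrite ler_pdivrMr// mul1r.
pose c := s * (2 / r); have c0 : 0 < c by rewrite mulr_gt0.
have -> : (\sum_(i < n.+1 | t i <= z) w i) / (\sum_(i < n.+1) w i) =
   (\sum_(i < n.+1 | t i <= z) c * w i) / (\sum_(i < n.+1) c * w i).
  by rewrite -!mulr_sumr -mulf_div divff ?gt_eqF// mul1r.
have -> : 7 * (2 * s + C2 / l + 12 * A) / r = 7 * ((2 * s + C2 / l + 12 * A) / r).
  by rewrite mulrA.
have q0 (x : R) : 0 < 1 + x ^+ 2 by rewrite ltr_wpDr// sqr_ge0.
have lr0 : 0 < l * r by rewrite mulr_gt0.
have [tail1 tail2] := tails _ lr0.
have tailE : C2 / (l * r) = C2 / l / r by rewrite invfM mulrA.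
have s20 : 0 < 2 * s by rewrite mulr_gt0.
have A120 : 0 < 12 * A by rewrite mulr_gt0.
have [S1 S2 S3] := ler_div_add3 r0 (ltW s20) (ltW B0) (ltW A120).
apply: (@normalized_partial_sums_near_cdf R Phi t (fun i => c * w i) n.+1) => //.
- by move=> i; rewrite tS lerDl ltW.
- by move=> i; rewrite mulr_ge0 ?(ltW c0).
- move=> i _; rewrite tS; apply: le_trans S1.
  have ti : t i <= t i + 2 / r by rewrite lerDl ltW.
  have unit (u : R) : t i <= u <= t i + 2 / r -> 0 <= expR (- u ^+ 2 / (2 * v)) <= 1.
    move=> _; rewrite expR_ge0/= -[leRHS]expR0 ler_expR mulNr oppr_le0.
    by rewrite divr_ge0 ?sqr_ge0// mulr_ge0// ltW.
  have /andP[_] := normal_cdf_increment_bounds v0 ti unit (lexx 0).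
  rewrite mulr1 [t i + _]addrC addrK; have -> : s * (2 / r) = 2 * s / r by ring.
  exact.
- apply: (le_trans (Phim _ (- (l * r)) _)); first by rewrite lerNr.
  by apply: (le_trans tail1); rewrite tailE.
- rewrite -lerN2 opprB; have := Phim _ _ tn; rewrite -/Phi => P1.
  by apply: le_trans (_ : - (1 - Phi (l * r)) <= _); [rewrite lerN2 (le_trans tail2)// tailE|lra].
- apply: le_trans S3.
  apply: (@le_trans _ _ (\sum_(i < n.+1) A / r * ((t i.+1 - t i) / (1 + t i ^+ 2)))).
    apply: ler_sum => i _.
    have -> : c * w i - (Phi (t i.+1) - Phi (t i)) =
      c * (w i - expR (- t i ^+ 2 / (2 * v))) -
      (Phi (t i + 2 / r) - Phi (t i) - s * expR (- t i ^+ 2 / (2 * v)) * (2 / r)).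
      by rewrite tS /c; ring.
    apply: (le_trans (ler_normB _ _)); rewrite normrM (gtr0_norm c0).
    have e1 := err i (ltac:(by rewrite -ltnS)).
    have e2 := cell (t i) (2 / r) (ltac:(by rewrite (ltW h0) h1)).
    apply: (le_trans (lerD (ler_wpM2l (ltW c0) e1) e2)).
    rewrite tS [t i + _]addrC addrK le_eqVlt; apply/predU1P; left.
    by rewrite /A /c; field; rewrite rn gt_eqF.
  rewrite -mulr_sumr; have -> : 12 * A / r = A / r * 12 by ring.
  rewrite ler_pM2l ?divr_gt0//; apply: sum_softsign => i.
  by rewrite tS lerDl (ltW h0)/= lerD2l; lra.
- by rewrite -mulr_sumr mulr_gt0.
Qed.

(** The weights restricted to the window are, after multiplication by a common
    factor, within the local error of a Gaussian on the whole lattice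
    ([local_estimate]), to which [lattice_sums_near_normal] applies; the lattice
    itself reaches [l * sqrt N] to both sides of [m].  For the finitely many [N]
    with [e' < 2 / N] the constant is so large that the bound exceeds [1]. *)
Lemma window_berry_esseen J h m a b : 0 < m < 1 -> g (tau J h m) = m ->
  0 < curvature J m -> a < m < b ->
  (forall x : R, 0 <= x <= 1 -> a <= x <= b -> x != m -> ptilde J h x < ptilde J h m) ->
  exists2 K : R, 0 < K & forall N : nat, (1 <= N)%N -> 0 < prob J h (window a b N) ->
    forall z, `|cond_prob J h (rescaled_le m N z) (window a b N) -
       centered_normal_cdf (curvature J m)^-1 z| <= K / Num.sqrt N%:R.
Proof.
move=> m01 gm ka0 amb win; have /andP[m0 m1] := m01.
have [e [C [e0 C0 local]]] := local_estimate m01 gm ka0 amb win.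
move: (curvature J m) ka0 local => ka ka0 local.
have v0 : 0 < ka^-1 by rewrite invr_gt0.
pose l := Num.min (m / 2) (1 - m).
have l0 : 0 < l by rewrite lt_min divr_gt0//= subr_gt0.
have [K0 K00 sums] := lattice_sums_near_normal v0 l0 C0.
pose e' := Num.min (Num.min e m) (2^-1).
have e'0 : 0 < e' by rewrite !lt_min e0 m0 invr_gt0 ltr0n.
exists (K0 + Num.sqrt (2 / e')); first by rewrite ltr_wpDr ?sqrtr_ge0.
move=> N N1 P0 z.
pose p : nat := odd N; pose n := N./2.
have NE : N = (p + 2 * n)%N by rewrite /p /n mul2n odd_double_half.
have p1 : (p <= 1)%N by rewrite /p; case: (odd N).
clearbody p n; subst N.
have n0 : 0 < (p + 2 * n)%:R :> R by rewrite ltr0n.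
have r0 : 0 < Num.sqrt (p + 2 * n)%:R :> R by rewrite sqrtr_gt0.
rewrite (cond_prob_window m z N1 p1 P0).
have := sum_window_gt0 N1 p1 P0.
set Y := \sum_(i < n.+1 | in_window _ _ _ _) _ => Y0.
have [small|large] := ltP e' (2 / (p + 2 * n)%:R).
  (* both probabilities lie in the unit interval *)
  set X := \sum_(i < n.+1 | _) _.
  have /andP[X0 XY] : 0 <= X / Y <= 1.
    rewrite divr_ge0 ?(ltW Y0)//=; last by apply: sumr_ge0 => *; exact: expR_ge0.
    rewrite ler_pdivrMr// mul1r /X /Y.
    rewrite [leRHS](bigID (fun i : 'I_n.+1 => below m z (p + 2 * n) (p + 2 * i)))/=.
    under eq_bigl do rewrite andbC.
    by rewrite lerDl; apply: sumr_ge0 => *; exact: expR_ge0.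
  have /andP[F0 F1] := @normal_cdf_bounded R ka^-1 z.
  apply: (@le_trans _ _ 1); first by rewrite ler_norml; apply/andP; split; lra.
  rewrite ler_pdivlMr// mul1r; apply: (@le_trans _ _ (Num.sqrt (2 / e'))).
    by rewrite ler_wsqrtr// ler_pdivlMr// mulrC -ler_pdivlMr// ltW.
  by rewrite lerDr ltW.
move: large; rewrite !le_min => /andP[/andP[Ne Nm] N2].
have [i0 loc] := local p n p1 N1 Ne.
apply: (@le_trans _ _ (K0 / Num.sqrt (p + 2 * n)%:R)); last first.
  by rewrite ler_pM2r ?invr_gt0// lerDl sqrtr_ge0.
pose t (i : nat) : R := ((p + 2 * i)%:R - (p + 2 * n)%:R * m) / Num.sqrt (p + 2 * n)%:R.
pose w (i : nat) : R := if in_window a b (p + 2 * n) (p + 2 * i)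
  then expR (chain_weight J h p n i - chain_weight J h p n i0) else 0.
pose E := expR (- chain_weight J h p n i0).
have E0 : 0 < E by exact: expR_gt0.
have wY (Q : pred 'I_n.+1) : \sum_(i < n.+1 | Q i) w i =
    E * \sum_(i < n.+1 | Q i && in_window a b (p + 2 * n) (p + 2 * i))
      expR (chain_weight J h p n i).
  rewrite mulr_sumr big_mkcondr; apply: eq_bigr => i _; rewrite /w.
  by case: ifP => // _; rewrite -expRD addrC.
have wYT : \sum_(i < n.+1) w i = E * Y by rewrite wY.
have -> : (\sum_(i < n.+1 | below m z (p + 2 * n) (p + 2 * i) &&
      in_window a b (p + 2 * n) (p + 2 * i)) expR (chain_weight J h p n i)) / Y =
    (\sum_(i < n.+1 | t i <= z) w i) / (\sum_(i < n.+1) w i).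
  by rewrite wYT wY -mulf_div divff ?gt_eqF// mul1r.
have rr : Num.sqrt (p + 2 * n)%:R ^+ 2 = (p + 2 * n)%:R :> R by rewrite sqr_sqrtr// ltW.
have Nm2 : 2 <= (p + 2 * n)%:R * m by move: Nm; rewrite ler_pdivrMr// mulrC.
have N4 : 4 <= (p + 2 * n)%:R :> R by move: N2; rewrite ler_pdivrMr//; lra.
have p1R : p%:R <= 1 :> R by rewrite -[leRHS]/(1%:R) ler_nat.
apply: sums => //.
- have <- : Num.sqrt (2 ^+ 2) = 2 :> R by rewrite sqrtr_sqr ger0_norm.
  by rewrite ler_wsqrtr// expr2; lra.
- by move=> i; rewrite /t mulnS addnCA natrD; ring.
- by move=> i; rewrite /w; case: ifP => // _; exact: expR_ge0.
- move=> i i_n; have := loc i i_n; rewrite -/(t i).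
  have -> : - t i ^+ 2 / (2 * ka^-1) = - (ka * t i ^+ 2 / 2) by field; rewrite gt_eqF.
  exact.
- rewrite /t muln0 addn0 -mulNr opprB ler_pdivlMr// -mulrA -expr2 rr.
  apply: (@le_trans _ _ (m / 2 * (p + 2 * n)%:R)).
    by rewrite ler_pM2r// ge_min lexx.
  by lra.
- rewrite /t ler_pdivlMr// -mulrA -expr2 rr.
  apply: (@le_trans _ _ ((1 - m) * (p + 2 * n)%:R)).
    by rewrite ler_pM2r// ge_min lexx orbT.
  by rewrite mulnS addnCA natrD; lra.
- by rewrite wYT mulr_gt0.
Qed.

End reduction.

Lemma Jc_gt0 (R : realType) : 0 < Jc R.
Proof.
rewrite /Jc invr_gt0 mulr_gt0// subr_gt0.
have : Num.sqrt 2 < 3 / 2 :> R.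
  have -> : 3 / 2 = Num.sqrt ((3 / 2) ^+ 2) :> R.
    by rewrite sqrtr_sqr ger0_norm ?divr_ge0.
  by rewrite ltr_sqrt ?exprn_gt0 ?divr_gt0//; lra.
lra.
Qed.

Lemma density_itv (R : realType) N (D : {set {set 'I_N}}) : 0 <= density R D <= 1.
Proof.
rewrite /density; case: N D => [|N] D; first by rewrite invr0 mulr0 lexx ler01.
rewrite divr_ge0//= ler_pdivrMr ?ltr0n// mul1r ler_nat.
by rewrite (leq_trans (max_card _))// card_ord.
Qed.

(** As the density lies in the unit interval, a bound of [-1] or [2] turns each
    half-line into a window. *)
Lemma dimers_ltE (R : realType) (xi : R) N : dimers_lt xi N = window (-1) xi N.
Proof.
apply/finset.setP => D; rewrite !inE; have /andP[d0 _] := density_itv R D.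
by rewrite [-1 < _](lt_le_trans _ d0)// ltrN10.
Qed.

Lemma dimers_gtE (R : realType) (xi : R) N : dimers_gt xi N = window xi 2 N.
Proof.
apply/finset.setP => D; rewrite !inE; have /andP[_ d1] := density_itv R D.
by rewrite [_ < 2](le_lt_trans d1) ?andbT// ltr1n.
Qed.

Section maximizers.
Context {R : realType}.
Implicit Types (J h m xi : R).

Lemma not_maximizer_lt J h m x : is_maximizer J h m -> 0 <= x <= 1 ->
  ~ is_maximizer J h x -> ptilde J h x < ptilde J h m.
Proof.
move=> [m01 mmax] x01 nx; rewrite ltNge; apply/negP => le; apply: nx.
by split => // y y01; exact: le_trans (mmax _ y01) le.
Qed.

Lemma curvatureE J h m : 0 < J -> g (tau J h m) = m -> 4 * J * m * (1 - m) < 2 - m ->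
  0 < curvature J m /\ limit_variance J h m = (curvature J m)^-1.
Proof.
move=> J0 gm Q; have m0 : 0 < m by rewrite -gm g_gt0.
have om0 : 0 < 1 - m by rewrite subr_gt0 -[ltLHS]gm g_lt1.
split; first by rewrite divr_gt0 ?mulr_gt0// subr_gt0.
by rewrite limit_varianceE// /curvature invf_div.
Qed.

End maximizers.

Theorem theorem2 (R : realType) (gamma : R -> R)
    (hgamma : critical_line gamma)
    (J h : R) (hJh : Gamma gamma J h)
    (m1 m2 : R) (hm12 : m1 < m2)
    (hm1 : is_maximizer J h m1) (hm2 : is_maximizer J h m2)
    (xi : R) (hxi : m1 < xi < m2) :
  0 < limit_variance J h m1 /\ 0 < limit_variance J h m2 /\
  exists2 K : R, 0 < K &
    forall N : nat, (1 <= N)%N ->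
      (0 < prob J h (dimers_lt xi N) ->
        (ereal_sup (range (fun z : R =>
           `| cond_prob J h (rescaled_le m1 N z) (dimers_lt xi N) -
              centered_normal_cdf (limit_variance J h m1) z |%:E))
         <= (K / Num.sqrt N%:R)%:E)%E) /\
      (0 < prob J h (dimers_gt xi N) ->
        (ereal_sup (range (fun z : R =>
           `| cond_prob J h (rescaled_le m2 N z) (dimers_gt xi N) -
              centered_normal_cdf (limit_variance J h m2) z |%:E))
         <= (K / Num.sqrt N%:R)%:E)%E).
Proof.
have J0 : 0 < J by case: hJh => JcJ _; exact: lt_trans (Jc_gt0 R) JcJ.
have [_ _ /(_ J h hJh)[n1 [n2 [_ maxE]]]] := hgamma.
have only x : is_maximizer J h x -> x = m1 \/ x = m2.
  move=> /maxE; have := (maxE m1).1 hm1; have := (maxE m2).1 hm2.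
  by move: hm12 => /[swap]-[->|->] /[swap]-[->|->] + [->|->];
    rewrite ?ltxx//; auto.
have /andP[xi1 xi2] := hxi.
have g1 := maximizer_fixed J0 hm1; have g2 := maximizer_fixed J0 hm2.
have [Q1 Q2] := two_maximizers_nondegenerate J0 hm12 hm1 hm2.
have [k1 v1] := curvatureE J0 g1 Q1; have [k2 v2] := curvatureE J0 g2 Q2.
have m01 : 0 < m1 < 1 by rewrite -g1 g_gt0 g_lt1.
have m02 : 0 < m2 < 1 by rewrite -g2 g_gt0 g_lt1.
(* the other maximizer lies outside the closed window *)
have win1 x : 0 <= x <= 1 -> -1 <= x <= xi -> x != m1 ->
    ptilde J h x < ptilde J h m1.
  move=> x01 /andP[_ xxi] xm; apply: (not_maximizer_lt hm1 x01) => /only[] xE.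
    by rewrite xE eqxx in xm.
  by have := le_lt_trans xxi xi2; rewrite xE ltxx.
have win2 x : 0 <= x <= 1 -> xi <= x <= 2 -> x != m2 ->
    ptilde J h x < ptilde J h m2.
  move=> x01 /andP[xxi _] xm; apply: (not_maximizer_lt hm2 x01) => /only[] xE.
    by have := lt_le_trans xi1 xxi; rewrite xE ltxx.
  by rewrite xE eqxx in xm.
have w1 : -1 < m1 < xi by rewrite xi1 andbT (lt_trans (ltrN10 R))//; case/andP: m01.
have w2 : xi < m2 < 2 by rewrite xi2 (lt_trans (_ : m2 < 1)) ?ltr1n//; case/andP: m02.
have [K1 K10 B1] := window_berry_esseen m01 g1 k1 w1 win1.
have [K2 K20 B2] := window_berry_esseen m02 g2 k2 w2 win2.
rewrite v1 v2 !invr_gt0; split => //; split => //.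
exists (K1 + K2); first exact: addr_gt0.
move=> N N1; have r0 : 0 < (Num.sqrt N%:R : R)^-1 by rewrite invr_gt0 sqrtr_gt0 ltr0n.
split=> P; apply: ge_ereal_sup => _ [z _ <-]; rewrite lee_fin.
- rewrite dimers_ltE in P *; apply: (le_trans (B1 N N1 P z)).
  by rewrite ler_pM2r// lerDl ltW.
- rewrite dimers_gtE in P *; apply: (le_trans (B2 N N1 P z)).
  by rewrite ler_pM2r// lerDr ltW.
Qed.
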